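(* Let $\|\cdot\|_{\mathcal P}$ be a norm on $\mathbb R^2$ whose closed unit ball $\mathcal P$ is a quadrilateral, with facets $\pm F_1,\pm F_2$. Let $\mathcal G=(G,p,\theta,\tau)$ be a well-positioned and $\mathcal C_2$-symmetric bar-joint framework in $(\mathbb R^2,\|\cdot\|_{\mathcal P})$, with quotient gain graph $(G_0,\psi)$ and induced monochrome subgraphs $G_{F_1,0}$, $G_{F_2,0}$ of $G_0$. (A) The following statements are equivalent: (i) $\mathcal G$ is $\chi_0$-symmetrically isostatic; (ii) $G_{F_1,0}$ and $G_{F_2,0}$ are edge-disjoint spanning unbalanced map graphs in $G_0$. (B) The following statements are equivalent: (i) $\mathcal G$ is $\chi_1$-symmetrically isostatic; (ii) $G_{F_1,0}$ and $G_{F_2,0}$ are edge-disjoint spanning trees in $G_0$. (C) The following statements are equivalent: (i) $\mathcal G$ is infinitesimally rigid; (ii) $G_{F_1,0}$ and $G_{F_2,0}$ both contain connected spanning unbalanced map graphs.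
   Context: Let $X=(\mathbb R^2,\|\cdot\|_{\mathcal P})$, $X_{\mathbb C}=\mathbb C\otimes_{\mathbb R}X$, and $\mathbb Z_2=\{1,-1\}$ with characters $\chi_0$ (trivial) and $\chi_1$ ($\chi_1(-1)=-1$). $\mathrm{Isom}(X)$ is the group of linear isometries. Real linear maps and their complex-linear extensions are denoted by the same symbol. A $\mathbb Z_2$-symmetric graph is $(G,\theta)$ with $G=(V,E)$ finite, simple, undirected and $\theta:\mathbb Z_2\to\mathrm{Aut}(G)$ a homomorphism acting freely on $V$; write $\gamma v,\gamma e$ for the action. A bar-joint framework in $X$ is $(G,p)$ with $p=(p_v)\in X^V$ having distinct components; it is well-positioned if $f_G:X^V\to\mathbb R^E$, $(x_v)\mapsto(\|x_v-x_w\|_{\mathcal P})_{vw\in E}$, is differentiable at $p$. A $\mathcal C_2$-symmetric bar-joint framework is $\mathcal G=(G,p,\theta,\tau)$ where $(G,p)$ is a bar-joint framework, $(G,\theta)$ is a $\mathbb Z_2$-symmetric graph, and $\tau:\mathbb Z_2\to\mathrm{Isom}(X)$ is a representation with $\tau(\gamma)p_v=p_{\gamma v}$ for all $\gamma,v$ and with $\tau(-1)$ the half-turn $-I$. A rigid motion of $X$ is a family of continuous paths $\{\alpha_x:[-1,1]\to X\}_{x\in X}$ with $\alpha_x(0)=x$ and $\|\alpha_x(t)-\alpha_y(t)\|_{\mathcal P}=\|x-y\|_{\mathcal P}$ for all $x,y,t$. $\mathcal T(X)$ is the space of vector fields $\eta(x)=\alpha_x'(0)$ arising from rigid motions, and $\mathcal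 T(X;\mathbb C)$ is the complex span of the fields $x\mapsto1\otimes\eta(x)$. $\mathcal G$ is infinitesimally rigid if $(G,p)$ is, that is, if $\ker df_G(p)=\{(\eta(p_v))_{v}:\eta\in\mathcal T(X)\}$. For a character $\chi$: $X_\chi=\{x\in(X_{\mathbb C})^V:x_{\gamma v}=\chi(\gamma)\tau(\gamma)x_v\ \forall\gamma,v\}$, $Y_\chi=\{y\in\mathbb C^E:y_{\gamma e}=\chi(\gamma)y_e\ \forall\gamma,e\}$, $\mathcal T_\chi(X)=\{\eta\in\mathcal T(X;\mathbb C):\eta(\tau(\gamma)x)=\chi(\gamma)\tau(\gamma)\eta(x)\ \forall\gamma,x\}$; $R_\chi:X_\chi\to Y_\chi$ is the restriction of $df_G(p)$ and $\rho_\chi:\mathcal T_\chi(X)\to X_\chi$, $\eta\mapsto(\eta(p_v))_v$. $\mathcal G$ is $\chi$-symmetrically isostatic if $\ker R_\chi=\mathrm{im}\,\rho_\chi$ and $R_\chi$ is surjective. Gain graph: $G_0=(V_0,E_0)$ is the quotient multigraph of vertex orbits $[v]$ and edge orbits $[e]$ ($[e]$ joins $[v]$ and $[w]$ if some edge of $[e]$ joins a vertex of $[v]$ to a vertex of $[w]$). After choosing a representative $\tilde v$ of each vertex orbit, the gain of an edge $[e]$ joining $[v]$ and $[w]$ is the $\gamma\in\mathbb Z_2$ with $\tilde v(\gamma\tilde w)\in[e]$ (loops have gain $-1$; other choices of representatives give equivalent gain graphs). The graph $G$ is called the covering graph of $(G_0,\psi)$. A cycle (loops and pairs of parallel edges count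 as cycles) is unbalanced if the product of its gains is $-1$. Framework colours: an edge $vw\in E$ has framework colour $F\in\{F_1,F_2\}$ if $p_v-p_w$ or $p_w-p_v$ lies in the cone $\{x\neq 0: x/\|x\|_{\mathcal P}\in F\}$; since $(G,p)$ is well-positioned each edge has exactly one framework colour, and an edge and its image under $-1$ have the same colour, which is then the colour of the edge orbit. $G_{F,0}$ is the subgraph of $G_0$ formed by the edges of colour $F$. It is said to be a spanning tree (spanning map graph) of $G_0$ if the graph with vertex set $V_0$ and the edges of $G_{F,0}$ is a tree (map graph). A map graph is a graph in which every connected component contains exactly one cycle; an unbalanced map graph is a $\mathbb Z_2$-gain graph whose underlying graph is a map graph, whose covering graph is simple, and in which every cycle is unbalanced.
   Formalization: In (B), (i)⇒(ii) is proved only when no edge of G is fixed by −1 (no loop in G_0); otherwise it is false: for V={v,−v} with the single edge {v,−v}, the framework is χ_1-isostatic, but a monochrome subgraph is a loop, not a tree. *)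

(* Defs.v *)
From mathcomp Require Export all_boot all_order all_algebra all_fingroup.
From mathcomp Require Export mxrepresentation complex.
From mathcomp Require Export boolp classical_sets functions cardinality reals.
From mathcomp Require Export topology normedtype derive.

Set Implicit Arguments.
Unset Strict Implicit.
Unset Printing Implicit Defensive.

Export Order.TTheory GRing.Theory Num.Theory numFieldNormedType.Exports.

(* The multiplicative group {1, -1} is the library's 'Z_2, whose group law
   is the one of group_scope: 1%g is the class of 0, and -1 is the class of 1. *)
Definition neg1 : 'Z_2 := Zp1.

(** * Z_2-gain graphs *)

(* [joins e u w] means that the edge e joins u and w (u = w for a loop). The gains
   need no orientation, because every element of Z_2 is its own inverse. *)
Record gain_graph := GainGraph {
  gvert : finType;
  gedge : finType;
  joins : gedge -> rel gvert;
  gain : gedge -> 'Z_2 }.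

Section GainGraphs.
Local Open Scope set_scope.
Variable H : gain_graph.

(* A set D of edges stands for the subgraph with all the vertices of H and the
   edges in D; so the properties below are those of a spanning subgraph. *)
Implicit Types (D C : {set gedge H}).

Definition adjacent D : rel (gvert H) := fun u w => [exists e in D, joins e u w].

Definition connected_graph D := forall u w, connect (adjacent D) u w.

Definition is_cycle C := exists k (v : 'I_k.+1 -> gvert H) (e : 'I_k.+1 -> gedge H),
  [/\ injective v, injective e, C = [set e i | i : 'I_k.+1]
    & forall i, joins (e i) (v i) (v (ordS i))].

Definition cycle_of D C := is_cycle C /\ C \subset D.

Definition unbalanced C := (\prod_(e in C) gain e)%g = neg1.

Definition is_tree D := connected_graph D /\ forall C, ~ cycle_of D C.

Definition in_component D (u : gvert H) C :=
  forall e w z, e \in C -> joins e w z -> connect (adjacent D) u w.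

Definition map_graph D :=
  forall u, exists! C, cycle_of D C /\ in_component D u C.

(* The edges of the covering graph, on the vertex set Z_2 x V_0, that lie over e;
   there is only one of them if e is a loop of gain -1. *)
Definition covering_edges (e : gedge H) : {set {set 'Z_2 * gvert H}} :=
  [set f : {set 'Z_2 * gvert H} | [exists u, exists w, exists h : 'Z_2,
     joins e u w && (f == [set (h, u); ((h * gain e)%g, w)])]].

Definition simple_covering D :=
  (forall e f, e \in D -> f \in covering_edges e -> #|f| = 2) /\
  (forall e e', e \in D -> e' \in D -> e != e' ->
     [disjoint covering_edges e & covering_edges e']).

Definition unbalanced_map_graph D :=
  [/\ map_graph D, simple_covering D & forall C, cycle_of D C -> unbalanced C].

End GainGraphs.

(** * Graphs with a Z_2-action and their quotient gain graphs *)

(* A simple graph on the finite vertex type V is given by its set E of edges. *)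
Section SymmetricGraphs.
Local Open Scope set_scope.
Variables (V : finType) (E : {set {set V}}).
Variable theta : {morphism [set: 'Z_2] >-> {perm V}}.

Definition simple_graph := forall e : {set V}, e \in E -> #|e| = 2.

Definition graph_aut : {set {perm V}} :=
  [set s : {perm V} | [set s @: (e : {set V}) | e in E] == E].

Definition Z2_symmetric_graph :=
  [/\ simple_graph, forall g, theta g \in graph_aut
    & forall g v, theta g v = v -> g = 1%g].

Definition vorbit (v : V) : {set V} := [set theta g v | g : 'Z_2].

Definition eorbit (e : {set V}) : {set {set V}} := [set theta g @: e | g : 'Z_2].

Definition qvert := {a : {set V} | a \in [set vorbit v | v : V]}.
Definition qedge := {o : {set {set V}} | o \in [set eorbit e | e in E]}.

Definition qjoins (o : qedge) : rel qvert := fun a b =>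
  [exists v in val a, exists w in val b, [set v; w] \in val o].

Definition representatives (rep : qvert -> V) := forall a, rep a \in val a.

(* The g such that the edge joining rep a to theta g (rep b) is in the orbit o,
   for orbits a and b that o joins. *)
Definition qgain (rep : qvert -> V) (o : qedge) : 'Z_2 :=
  odflt 1%g [pick g : 'Z_2 | [exists a, exists b,
    qjoins o a b && ([set rep a; theta g (rep b)] \in val o)]].

Definition quotient_gain_graph (rep : qvert -> V) : gain_graph :=
  GainGraph qjoins (qgain rep).

(* The edges fixed by -1 are those whose orbits are the loops of the quotient graph.
   A vector of Y_chi1 is zero at such an edge, so that chi1-isostaticity does not
   see it; but a loop is a cycle, and a tree has none. For the two vertices v and -v
   and the edge between them, the framework is chi1-isostatic, but the monochrome
   subgraphs are not both trees. *)
Definition no_fixed_edge := forall e, e \in E -> theta neg1 @: e != e.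

End SymmetricGraphs.

(** * Quadrilateral norms on R^2 *)

Section Norms.
Local Open Scope classical_set_scope.
Local Open Scope card_scope.
Local Open Scope ring_scope.
Variable R : realType.
Implicit Types (nrm : 'rV[R]_2 -> R) (P F : set 'rV[R]_2).

Definition is_norm nrm :=
  [/\ forall x, nrm x = 0 -> x = 0,
      forall a x, nrm (a *: x) = `|a| * nrm x
    & forall x y, nrm (x + y) <= nrm x + nrm y].

Definition unit_ball nrm : set 'rV[R]_2 := [set x | nrm x <= 1].

Definition is_polytope P := exists n (s : 'I_n -> 'rV[R]_2),
  P = [set x | exists a : 'I_n -> R,
    [/\ forall i, 0 <= a i, \sum_i a i = 1 & x = \sum_i a i *: s i]].

(* The proper exposed faces of dimension 1 *)
Definition is_facet P F := exists (u : 'cV[R]_2) (c : R),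
  [/\ u != 0,
      forall x, P x -> (x *m u) 0 0 <= c,
      F = [set x | P x /\ (x *m u) 0 0 = c]
    & exists x y, [/\ F x, F y & x != y]].

Definition facets P : set (set 'rV[R]_2) := [set F | is_facet P F].

Definition quadrilateral P := is_polytope P /\ facets P #= `I_4.

Definition opp_set F : set 'rV[R]_2 := [set - x | x in F].

Definition facet_cone nrm F : set 'rV[R]_2 :=
  [set x | x != 0 /\ F ((nrm x)^-1 *: x)].

(* The values of alpha x outside [-1, 1] play no role. Continuity and
   differentiability are with respect to the maximum norm of the library,
   hence with respect to nrm, as all norms on R^2 are equivalent. *)
Definition rigid_motion nrm (alpha : 'rV[R]_2 -> R -> 'rV[R]_2) :=
  [/\ forall x, {within `[-1, 1], continuous (alpha x)},
      forall x, alpha x 0 = x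
    & forall x y t, t \in `[-1, 1] ->
        nrm (alpha x t - alpha y t) = nrm (x - y)].

Definition motion_fields nrm : set ('rV[R]_2 -> 'rV[R]_2) :=
  [set eta | exists2 alpha, rigid_motion nrm alpha
     & forall x, is_derive (0 : R) (1 : R) (alpha x) (eta x)].

Definition complexify m n (x : 'M[R]_(m, n)) : 'M[R[i]]_(m, n) :=
  map_mx (real_complex R) x.

Definition complex_extension m n m' n' (f : 'M[R]_(m, n) -> 'M[R]_(m', n'))
    (z : 'M[R[i]]_(m, n)) : 'M[R[i]]_(m', n') :=
  complexify (f (map_mx (@complex.Re R) z)) +
  (0 +i* 1)%C *: complexify (f (map_mx (@complex.Im R) z)).

Definition complex_motion_fields nrm : set ('rV[R]_2 -> 'rV[R[i]]_2) :=
  [set zeta | exists n (c : 'I_n -> R[i]) (eta : 'I_n -> 'rV[R]_2 -> 'rV[R]_2),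
     (forall i, motion_fields nrm (eta i)) /\
     forall x, zeta x = \sum_i c i *: complexify (eta i x)].

End Norms.

(** * Bar-joint frameworks *)

Section Frameworks.
Local Open Scope classical_set_scope.
Local Open Scope card_scope.
Local Open Scope ring_scope.
Variables (R : realType) (nrm : 'rV[R]_2 -> R).
Variables (V : finType) (E : {set {set V}}).

(* A family of row vectors indexed by V is a matrix with one row for each vertex;
   a family of scalars indexed by E is a row vector. *)
Definition at_vertex (K : Type) (x : 'M[K]_(#|V|, 2)) (v : V) : 'rV[K]_2 :=
  row (enum_rank v) x.

(* Which of v and w comes first is irrelevant, as nrm is even. *)
Definition edge_length (x : 'M[R]_(#|V|, 2)) (e : {set V}) : R :=
  if [pick vw : V * V | e == [set vw.1; vw.2]%SET] is Some vw
  then nrm (at_vertex x vw.1 - at_vertex x vw.2) else 0.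

Definition rigidity_map (x : 'M[R]_(#|V|, 2)) : 'rV[R]_#|E| :=
  \row_i edge_length x (enum_val i).

Variable p : 'M[R]_(#|V|, 2).

Definition bar_joint_framework := simple_graph E /\ injective (at_vertex p).

Definition well_positioned := differentiable rigidity_map p.

Definition infinitesimally_rigid :=
  [set x | 'd rigidity_map p x = 0] =
  [set x | exists2 eta, motion_fields nrm eta
     & forall v, at_vertex x v = eta (at_vertex p v)].

Definition framework_colour (F : set 'rV[R]_2) (e : {set V}) :=
  exists v w, e = [set v; w]%SET /\
    (facet_cone nrm F (at_vertex p v - at_vertex p w) \/
     facet_cone nrm F (at_vertex p w - at_vertex p v)).

Variable theta : {morphism [set: 'Z_2]%SET >-> {perm V}}.

(* Linear maps act on row vectors from the right. *)
Variable tau : mx_representation R [set: 'Z_2]%SET 2.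

Definition C2_symmetric_framework :=
  [/\ bar_joint_framework, Z2_symmetric_graph E theta,
      forall g x, nrm (x *m tau g) = nrm x,
      forall g v, at_vertex p v *m tau g = at_vertex p (theta g v)
    & tau neg1 = - 1%:M].

(* The edges of the monochrome subgraph of the quotient graph *)
Definition monochrome (F : set 'rV[R]_2) : {set qedge E theta} :=
  [set o : qedge E theta |
     `[< exists2 e, e \in val o & framework_colour F e >]]%SET.

Variable chi : 'Z_2 -> R[i].

Definition X_chi : set 'M[R[i]]_(#|V|, 2) :=
  [set x | forall g v, at_vertex x (theta g v) =
     chi g *: (at_vertex x v *m complexify (tau g))].

Definition Y_chi : set 'rV[R[i]]_#|E| :=
  [set y | forall g (i j : 'I_#|E|),
     enum_val j = (theta g @: (enum_val i : {set V}))%SET ->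
     y 0 j = chi g * y 0 i].

Definition T_chi : set ('rV[R]_2 -> 'rV[R[i]]_2) :=
  [set eta | complex_motion_fields nrm eta /\
     forall g x, eta (x *m tau g) = chi g *: (eta x *m complexify (tau g))].

Definition complex_differential : 'M[R[i]]_(#|V|, 2) -> 'rV[R[i]]_#|E| :=
  complex_extension ('d rigidity_map p).

Definition chi_isostatic :=
  [set x | X_chi x /\ complex_differential x = 0] =
    [set x | exists2 eta, T_chi eta
       & forall v, at_vertex x v = eta (at_vertex p v)] /\
  forall y, Y_chi y -> exists2 x, X_chi x & complex_differential x = y.

End Frameworks.

Definition chi0 (R : realType) : 'Z_2 -> R[i] := fun _ => 1%R.
Definition chi1 (R : realType) : 'Z_2 -> R[i] := fun g => ((-1) ^+ g)%R.

(* Main.v *)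
(* The unit ball is a parallelogram, so in suitable coordinates the norm is
   max(|x_0|, |x_1|) and F_k is the side x_k = 1. Differentiability at p forces the two
   coordinates of p_v - p_w to have distinct absolute values for every edge vw; the
   larger one is the colour of the edge, and the row of the rigidity matrix at vw is
   plus or minus the difference x_v - x_w in that coordinate. So the rigidity matrix is
   the direct sum of the incidence matrices of the two monochrome graphs. Rigid motions
   are translations, because the dominant coordinate of alpha_x - alpha_y is constant
   near 0 and any two points are joined through a third one from which both differ
   mostly in a prescribed coordinate.

   A vector of X_chi0 (of X_chi1) is odd (even) under the half-turn, so on it each
   incidence matrix becomes that of the quotient gain graph, with the entry signs given
   by the gains (with constant signs). Call a function F on the vertices with
   F u = eps_e F w on every edge e = uw of D a potential of D. The constant potentials
   are the only ones if and only if D is connected (eps = 1); zero is the only one if and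
   only if every component has an unbalanced cycle (eps = gain). The matrix is onto if
   and only if for each edge some function has its only defect there; this excludes
   balanced cycles and two cycles in one component. Splitting real functions
   into even and odd parts gives the statement on infinitesimal rigidity. *)
Require Import Defs.
From mathcomp Require Import ring lra.

Set Implicit Arguments.
Unset Strict Implicit.
Unset Printing Implicit Defensive.

Local Open Scope ring_scope.

(** * Parallelogram norms *)

Section Plane.
Variable R : realType.
Implicit Types (x y s t : 'rV[R]_2) (u : 'cV[R]_2).

Definition det2 x y : R := x 0 0 * y 0 1 - x 0 1 * y 0 0.

Lemma ord2P (i : 'I_2) : i = 0 \/ i = 1.
Proof. by case: i => [[|[|]]] // ?; [left | right]; apply: val_inj. Qed.

Lemma row2P x y : x 0 0 = y 0 0 -> x 0 1 = y 0 1 -> x = y.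
Proof. by move=> e0 e1; apply/rowP => i; case: (ord2P i) => ->. Qed.

Lemma dot2E x (m : nat) (u : 'M[R]_(2, m)) j :
  (x *m u) 0 j = x 0 0 * u 0 j + x 0 1 * u 1 j.
Proof.
rewrite mxE !big_ord_recl big_ord0 addr0.
by congr (_ * _ + _ * u _ j); [congr (x 0 _)|]; apply: val_inj.
Qed.

(** Cramer's rule in the basis formed by [s] and [t]. *)
Lemma det2_basis s t y : det2 s t != 0 ->
  y = (det2 y t / det2 s t) *: s + (det2 s y / det2 s t) *: t.
Proof.
by move=> st0; apply: row2P; rewrite !mxE /det2; field; exact: st0.
Qed.

(** For independent [s] and [t], the functional whose level set at 1 is the line through both. *)
Definition line_functional s t : 'cV[R]_2 :=
  \col_i ((if i == 0 then t 0 1 - s 0 1 else s 0 0 - t 0 0) / det2 s t).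

Lemma line_functional_l s t : det2 s t != 0 -> (s *m line_functional s t) 0 0 = 1.
Proof. by move=> st0; rewrite dot2E !mxE /= /det2; field; exact: st0. Qed.

Lemma line_functional_r s t : det2 s t != 0 -> (t *m line_functional s t) 0 0 = 1.
Proof. by move=> st0; rewrite dot2E !mxE /= /det2; field; exact: st0. Qed.

(** Induction on the number of nonzero weights. More than two vectors of the plane are linearly
    dependent; a multiple of the dependence is subtracted from the weights until one more of them
    vanishes. The sign of the dependence is chosen so that the total weight does not grow. *)
Lemma caratheodory2 n (s : 'I_n.+1 -> 'rV[R]_2) (a : 'I_n.+1 -> R) :
    (forall i, 0 <= a i) -> exists i j b c,
  [/\ 0 <= b, 0 <= c, b + c <= \sum_k a k & \sum_k a k *: s k = b *: s i + c *: s j].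
Proof.
have [m] := ubnP #|[set i | a i != 0]|%SET.
elim: m a => // m IHm a lem a0; pose S := [set i | a i != 0]%SET.
have [leS2 | ltS2] := leqP #|S| 2.
  have [i [j sS]] : exists i j, forall k, k != i -> k != j -> a k = 0.
    have [S0 | [i iS]] := set_0Vmem S.
      exists ord0, ord0 => k _ _; apply/eqP/negPn/negP => ak.
      by have : k \in S by [rewrite inE]; rewrite S0 inE.
    exists i; have [S0 | [j jS]] := set_0Vmem (S :\ i)%SET.
      exists ord0 => k ki _; apply/eqP/negPn/negP => ak.
      by have : k \in (S :\ i)%SET by [rewrite !inE ki]; rewrite S0 inE.
    exists j => k ki kj; apply/eqP/negPn/negP => ak; move: leS2.
    rewrite (cardsD1 i) iS (cardsD1 j) jS (cardsD1 k) !inE ki kj ak //.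
  have [ij | nij] := eqVneq i j.
    exists i, j, (a i), 0; rewrite ij in sS *; split=> //.
      by rewrite addr0 (bigD1 j) //= lerDl sumr_ge0.
    rewrite scale0r addr0 (bigD1 j) //= big1 ?addr0 // => k kj.
    by rewrite sS ?scale0r.
  exists i, j, (a i), (a j); split=> //.
    rewrite (bigD1 i) //= lerD2l (bigD1 j) ?lerDl ?sumr_ge0 //= eq_sym //.
  rewrite (bigD1 i) //= (bigD1 j) 1?eq_sym //= big1 ?addr0 // => k /andP[ki kj].
  by rewrite sS ?scale0r.
have [c [cS c0 sc0 [i0 ci0]]] : exists c : 'I_n.+1 -> R,
    [/\ forall i, a i = 0 -> c i = 0, \sum_i c i *: s i = 0, 0 <= \sum_i c i
      & exists i, 0 < c i].
  have [c [cS c0 [i ci]]] : exists c : 'I_n.+1 -> R,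
      [/\ forall i, a i = 0 -> c i = 0, \sum_i c i *: s i = 0 & exists i, c i != 0].
    have [k0 k0S] : exists k, k \in S.
      by have /card_gt0P := leq_trans (isT : (0 < 3)%N) ltS2.
    pose B := \matrix_(k < #|S|) s (enum_val k).
    have : kermx B != 0.
      rewrite kermx_eq0 -row_leq_rank -ltnNge (leq_ltn_trans (rank_leq_col B)) //.
    case/rowV0Pn=> v /sub_kermxP vB v0.
    exists (fun i => if i \in S then v 0 (enum_rank_in k0S i) else 0); split.
    - by move=> i ai; rewrite inE ai eqxx.
    - rewrite (bigID (mem S)) /= [X in _ + X]big1 ?addr0; last first.
        by move=> i /negPf->; rewrite scale0r.
      rewrite (eq_bigr (fun i => v 0 (enum_rank_in k0S i) *: s i)); last first.
        by move=> i ->.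
      rewrite -[RHS]vB mulmx_sum_row big_enum_val; apply: eq_bigr => k _.
      by rewrite enum_valK_in rowK.
    - have [k vk] : exists k, v 0 k != 0.
        by case/matrix0Pn: v0 => z [k vk]; exists k; rewrite -(ord1 z).
      by exists (enum_val k); rewrite enum_valP enum_valK_in.
  wlog sc0 : c cS c0 ci / 0 <= \sum_i c i.
    move=> wl; have [sc|/ltW sc] := leP 0 (\sum_i c i); first exact: (wl c).
    apply: (wl (fun i => - c i)).
    - by move=> k /cS->; rewrite oppr0.
    - by under eq_bigr do rewrite scaleNr; rewrite sumrN c0 oppr0.
    - by rewrite oppr_eq0.
    - by rewrite sumrN oppr_ge0.
  (* Coefficients that are all nonpositive but have a nonnegative sum would all be zero. *)
  exists c; split=> //; apply: contrapT => nc.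
  have c_le0 k : c k <= 0 by rewrite leNgt; apply/negP => ck; apply: nc; exists k.
  case/negP: ci; rewrite eq_le c_le0 -oppr_le0.
  rewrite -[X in _ <= X](_ : \sum_k - c k = 0).
    by rewrite (bigD1 i) //= lerDl sumr_ge0 // => k _; rewrite oppr_ge0.
  by apply/eqP; rewrite sumrN oppr_eq0 eq_le sc0 andbT sumr_le0.
have i0P : 0 < c i0 by [].
case: (Order.TotalTheory.arg_minP (P := fun i => 0 < c i) (fun i => a i / c i) i0P).
move=> i1 /= ci1 mini1.
(* The largest multiple of [c] that leaves all weights nonnegative; the weight at [i1] becomes
   zero. *)
pose t := a i1 / c i1.
have t0 : 0 <= t by rewrite divr_ge0 // ltW.
have [|i|i [j [b [d [b0 d0 lebd Ebd]]]]] := IHm (fun i => a i - t * c i).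
- rewrite -ltnS; apply: leq_trans lem; rewrite ltnS; apply: proper_card.
  apply/properP; split; last first.
    exists i1; rewrite !inE.
      by apply: contraTneq ci1 => /cS->; rewrite ltxx.
    by rewrite /t divfK ?subrr ?eqxx // gt_eqF.
  apply/fintype.subsetP => i; rewrite !inE; apply: contraNneq => ai.
  by rewrite ai (cS i) // mulr0 subrr.
- have [ci | ci] := ltP 0 (c i); first by rewrite subr_ge0 -ler_pdivlMr // mini1.
  by rewrite subr_ge0 (le_trans _ (a0 i)) // mulr_ge0_le0.
exists i, j, b, d; split=> //.
  apply: le_trans lebd _; rewrite sumrB lerBlDr lerDl -mulr_sumr mulr_ge0 //.
rewrite -Ebd; under [RHS]eq_bigr do rewrite scalerBl -scalerA.
by rewrite sumrB -scaler_sumr c0 scaler0 subr0.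
Qed.

End Plane.

(** * Quadrilateral norms as maxima of two coordinates *)

Section QuadrilateralNorm.
Variables (R : realType) (nrm : 'rV[R]_2 -> R).
Hypothesis nrm_norm : is_norm nrm.
Implicit Types (x y : 'rV[R]_2) (u : 'cV[R]_2).

Lemma nrmZ a x : nrm (a *: x) = `|a| * nrm x.
Proof. by case: nrm_norm. Qed.

Lemma nrmD x y : nrm (x + y) <= nrm x + nrm y.
Proof. by case: nrm_norm. Qed.

Lemma nrm_eq0 x : nrm x = 0 -> x = 0.
Proof. by case: nrm_norm => + _ _; apply. Qed.

Lemma nrm0 : nrm 0 = 0.
Proof. by rewrite -(scale0r 0) nrmZ normr0 mul0r. Qed.

Lemma nrmN x : nrm (- x) = nrm x.
Proof. by rewrite -scaleN1r nrmZ normrN1 mul1r. Qed.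

Lemma nrm_ge0 x : 0 <= nrm x.
Proof.
have := nrmD x (- x); rewrite subrr nrm0 nrmN -mulr2n -mulr_natr.
by rewrite pmulr_lge0.
Qed.

Lemma nrm_gt0 x : x != 0 -> 0 < nrm x.
Proof.
move=> x0; rewrite lt_neqAle nrm_ge0 andbT eq_sym.
by apply: contraNneq x0 => /nrm_eq0->.
Qed.

(** Homogeneity carries the bound from the ball to the plane, and applying it to [- x] as well
    bounds the absolute value. *)
Lemma functional_bound u : (forall x, nrm x <= 1 -> (x *m u) 0 0 <= 1) ->
  forall x, `|(x *m u) 0 0| <= nrm x.
Proof.
move=> u1 x; have [->|x0] := eqVneq x 0; first by rewrite mul0mx mxE normr0 nrm0.
have le_u y : y != 0 -> (y *m u) 0 0 <= nrm y.
  move=> /nrm_gt0 y0; have := u1 ((nrm y)^-1 *: y).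
  rewrite nrmZ ger0_norm ?invr_ge0 ?nrm_ge0 // mulVf ?gt_eqF // => /(_ (lexx _)).
  by rewrite -scalemxAl mxE ler_pdivrMl // mulr1.
rewrite ler_norml le_u // andbT lerNl -nrmN.
by have := le_u (- x); rewrite oppr_eq0 mulNmx mxE; apply.
Qed.

(** The supporting value [c] is positive, because the functional [u] is positive at the multiple of
    [u^T] of norm 1; dividing [u] by [c] normalises the value to 1. *)
Lemma facet_functional (F : set 'rV[R]_2) : is_facet (unit_ball nrm) F -> exists u,
  (forall x, `|(x *m u) 0 0| <= nrm x) /\
  F = [set x | nrm x <= 1 /\ (x *m u) 0 0 = 1]%classic.
Proof.
case=> u [c [u0 uc -> _]].
have c0 : 0 < c.
  have uT0 : u^T != 0 by rewrite trmx_eq0.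
  have := uc ((nrm u^T)^-1 *: u^T); rewrite /unit_ball /= nrmZ.
  rewrite ger0_norm ?invr_ge0 ?nrm_ge0 // mulVf ?gt_eqF ?nrm_gt0 // => /(_ (lexx _)).
  apply: lt_le_trans; rewrite -scalemxAl mxE mulr_gt0 ?invr_gt0 ?nrm_gt0 //.
  rewrite dot2E !mxE -!expr2 lt_neqAle addr_ge0 ?sqr_ge0 // andbT eq_sym.
  rewrite paddr_eq0 ?sqr_ge0 // !sqrf_eq0; apply: contra u0 => /andP[/eqP u00 /eqP u10].
  apply/eqP/colP => i; rewrite mxE; case: (ord2P i) => -> //.
have cu x : (x *m (c^-1 *: u)) 0 0 = c^-1 * (x *m u) 0 0.
  by rewrite -scalemxAr mxE.
exists (c^-1 *: u); split.
  by apply: functional_bound => x /uc; rewrite cu ler_pdivrMl // mulr1.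
apply/seteqP; split=> x [nx xc]; split; rewrite // ?cu.
  by rewrite xc mulVf ?gt_eqF.
by move: xc; rewrite cu => /(congr1 ( *%R c)); rewrite mulVKf ?gt_eqF // mulr1.
Qed.

Hypothesis ball_polytope : is_polytope (unit_ball nrm).

(* By Caratheodory, x is a combination of two vertices whose weights add up to nrm x, and
   genericity makes these a basis. The functional equal to 1 at both vertices is at most
   1 on the ball: otherwise a point where it is larger would give x a smaller norm. *)
Lemma generic_in_facet : exists N (s : 'I_N -> 'rV[R]_2),
  forall x, x != 0 -> (forall i, s i != 0 -> det2 x (s i) != 0) ->
  exists F, facets (unit_ball nrm) F /\ F ((nrm x)^-1 *: x).
Proof.
have [N [s defP]] := ball_polytope; exists N, s => x x0 gen_x.
have s1 i : nrm (s i) <= 1.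
  suff : unit_ball nrm (s i) by [].
  rewrite defP; exists (fun j => (j == i)%:R); split.
  - by move=> j; rewrite ler0n.
  - by rewrite (bigD1 i) //= eqxx big1 ?addr0 // => j /negPf->.
  - by rewrite (bigD1 i) //= eqxx scale1r big1 ?addr0 // => j /negPf->; rewrite scale0r.
have nx0 := nrm_gt0 x0.
have [i [j [a [b [a0 b0 leab defx]]]]] : exists i j a b,
    [/\ 0 <= a, 0 <= b, a + b <= nrm x & x = a *: s i + b *: s j].
  have : unit_ball nrm ((nrm x)^-1 *: x).
    by rewrite /unit_ball /= nrmZ ger0_norm ?invr_ge0 ?nrm_ge0 // mulVf ?gt_eqF.
  rewrite defP => -[al [al0 sal defx]].
  have {}defx : x = \sum_i (nrm x * al i) *: s i.
    by rewrite -[LHS](scalerKV (lt0r_neq0 nx0)) defx scaler_sumr;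
       apply: eq_bigr => i _; rewrite scalerA.
  case: N s s1 al al0 sal defx {gen_x defP} => [|N] s s1 al al0 sal defx.
    by move: sal; rewrite big_ord0 => /eqP; rewrite eq_sym oner_eq0.
  have [|i [j [a [b [a0 b0 leab]]]]] := @caratheodory2 _ _ s (fun i => nrm x * al i).
    by move=> i; rewrite mulr_ge0 // ltW.
  rewrite -defx => {}defx; exists i, j, a, b; split=> //.
  by rewrite -mulr_sumr sal mulr1 in leab.
have eqab : a + b = nrm x.
  apply/eqP; rewrite eq_le leab {1}defx (le_trans (nrmD _ _)) // !nrmZ !ger0_norm //.
  by rewrite lerD // ler_piMr.
have sij0 : det2 (s i) (s j) != 0.
  apply: contraNneq x0 => sij.
  have dxi : det2 x (s i) = 0.
    by transitivity (- b * det2 (s i) (s j)); [rewrite defx /det2 !mxE; ring | rewrite sij mulr0].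
  have dxj : det2 x (s j) = 0.
    by transitivity (a * det2 (s i) (s j)); [rewrite defx /det2 !mxE; ring | rewrite sij mulr0].
  have [si0|si0] := eqVneq (s i) 0; last by have := gen_x i si0; rewrite dxi eqxx.
  have [sj0|sj0] := eqVneq (s j) 0; last by have := gen_x j sj0; rewrite dxj eqxx.
  by rewrite defx si0 sj0 !scaler0 addr0.
have sneq0 : s i != 0 /\ s j != 0.
  by split; apply: contraNneq sij0 => ->; rewrite /det2 !mxE ?mul0r ?mulr0 subrr.
have {}a0 : 0 < a.
  rewrite lt_neqAle a0 andbT eq_sym; apply/eqP => a00.
  have := gen_x j (proj2 sneq0); rewrite defx a00 scale0r add0r.
  suff -> : det2 (b *: s j) (s j) = 0 by rewrite eqxx.
  by rewrite /det2 !mxE; ring.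
have {}b0 : 0 < b.
  rewrite lt_neqAle b0 andbT eq_sym; apply/eqP => b00.
  have := gen_x i (proj1 sneq0); rewrite defx b00 scale0r addr0.
  suff -> : det2 (a *: s i) (s i) = 0 by rewrite eqxx.
  by rewrite /det2 !mxE; ring.
pose u := line_functional (s i) (s j).
have uE c d : ((c *: s i + d *: s j) *m u) 0 0 = c + d.
  rewrite mulmxDl -!scalemxAl mxE [X in X + _]mxE [X in _ + X]mxE.
  by rewrite line_functional_l // line_functional_r // !mulr1.
have u_le1 y : nrm y <= 1 -> (y *m u) 0 0 <= 1.
  move=> y1; rewrite leNgt; apply/negP; rewrite {1}(det2_basis y sij0) uE.
  set c := _ / _; set d := _ / _ => cd1.
  (* Small enough for [x - t *: y] to keep nonnegative coefficients on [s i] and [s j]; as [c + d]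
     exceeds 1, trading this part for [t *: y] lowers the bound on the norm of [x]. *)
  pose t := Num.min a b / (1 + `|c| + `|d|).
  have den0 : 0 < 1 + `|c| + `|d| by rewrite -addrA ltr_pwDl // addr_ge0.
  have t0 : 0 < t by rewrite divr_gt0 // lt_min a0.
  have tden : t * (1 + `|c| + `|d|) = Num.min a b by rewrite divfK ?gt_eqF.
  have tca : 0 <= a - t * c.
    have le1 : Num.min a b <= a by rewrite ge_min lexx.
    rewrite subr_ge0 (le_trans _ le1) // -tden ler_pM2l //.
    by have := ler_norm c; have := normr_ge0 d; lra.
  have tdb : 0 <= b - t * d.
    have le1 : Num.min a b <= b by rewrite ge_min lexx orbT.
    rewrite subr_ge0 (le_trans _ le1) // -tden ler_pM2l //.
    by have := ler_norm d; have := normr_ge0 c; lra.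
  have Ex : x = (a - t * c) *: s i + (b - t * d) *: s j + t *: y.
    rewrite [in RHS](det2_basis y sij0) -/c -/d defx scalerDr !scalerA !scalerBl.
    by rewrite addrACA !subrK.
  have : nrm x <= (a - t * c) + (b - t * d) + t.
    rewrite {1}Ex (le_trans (nrmD _ _)) // lerD //.
      by rewrite (le_trans (nrmD _ _)) // !nrmZ !ger0_norm // lerD // ler_piMr.
    by rewrite nrmZ gtr0_norm // ler_piMr // ltW.
  have : t * 1 < t * (c + d) by rewrite ltr_pM2l.
  by rewrite -eqab; lra.
exists [set y | unit_ball nrm y /\ (y *m u) 0 0 = 1]%classic; split; last first.
  split; first by rewrite /unit_ball /= nrmZ ger0_norm ?invr_ge0 ?nrm_ge0 // mulVf ?gt_eqF.
  by rewrite -scalemxAl mxE {2}defx uE eqab mulVf ?gt_eqF.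
exists u, 1; split=> //.
  apply: contra_neq (oner_neq0 R) => u0.
  by rewrite -(line_functional_l sij0) -/u u0 mulmx0 mxE.
exists (s i), (s j); split.
- by split; [apply: s1 | apply: line_functional_l].
- by split; [apply: s1 | apply: line_functional_r].
- by apply: contraNneq sij0 => ->; rewrite /det2 mulrC subrr.
Qed.

Variables (F1 F2 : set 'rV[R]_2).
Hypothesis ball_facets : facets (unit_ball nrm) =
                   [set F1; opp_set F1; F2; opp_set F2]%classic.

(** The columns of [M] are the normalised functionals of [F1] and [F2], so the maximum [m] is at
    most the norm. At a generic point the normalised vector lies on one of the four facets, which
    gives equality; any other point is approximated by generic ones. *)
Lemma quadrilateral_normP : exists M : 'M[R]_2, [/\ M \in unitmx,
  forall x, nrm x = Num.max `|(x *m M) 0 0| `|(x *m M) 0 1|,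
  F1 = [set x | nrm x <= 1 /\ (x *m M) 0 0 = 1]%classic &
  F2 = [set x | nrm x <= 1 /\ (x *m M) 0 1 = 1]%classic].
Proof.
have [u1 [le1 defF1]] : exists u, (forall x, `|(x *m u) 0 0| <= nrm x) /\
    F1 = [set x | nrm x <= 1 /\ (x *m u) 0 0 = 1]%classic.
  apply: facet_functional; suff : facets (unit_ball nrm) F1 by [].
  by rewrite ball_facets; left; left; left.
have [u2 [le2 defF2]] : exists u, (forall x, `|(x *m u) 0 0| <= nrm x) /\
    F2 = [set x | nrm x <= 1 /\ (x *m u) 0 0 = 1]%classic.
  apply: facet_functional; suff : facets (unit_ball nrm) F2 by [].
  by rewrite ball_facets; left; right.
pose M : 'M[R]_2 := \matrix_(i, j) (if j == 0 then u1 i 0 else u2 i 0).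
have M0 x : (x *m M) 0 0 = (x *m u1) 0 0 by rewrite !dot2E !mxE.
have M1 x : (x *m M) 0 1 = (x *m u2) 0 0 by rewrite !dot2E !mxE.
pose m x := Num.max `|(x *m M) 0 0| `|(x *m M) 0 1|.
have le_m x : m x <= nrm x by rewrite /m ge_max M0 M1 le1 le2.
have [N [s genP]] := generic_in_facet.
have cone u x (F : set 'rV[R]_2) : F = [set x | nrm x <= 1 /\ (x *m u) 0 0 = 1]%classic ->
    x != 0 -> F ((nrm x)^-1 *: x) \/ opp_set F ((nrm x)^-1 *: x) ->
    nrm x = `|(x *m u) 0 0|.
  move=> -> /nrm_gt0 x0 Fx; apply/esym.
  suff : `|(((nrm x)^-1 *: x) *m u) 0 0| = 1.
    rewrite -scalemxAl mxE normrM gtr0_norm ?invr_gt0 // => /(congr1 ( *%R (nrm x))).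
    by rewrite mulVKf ?gt_eqF // mulr1.
  by case: Fx => [[_ ->]|[y [_ yu] <-]]; rewrite ?normr1 // mulNmx mxE yu normrN1.
have gen_m x : x != 0 -> (forall i, s i != 0 -> det2 x (s i) != 0) -> nrm x <= m x.
  move=> x0 /(genP x x0)[F [facF Fx]]; move: facF; rewrite ball_facets.
  rewrite /m le_max M0 M1 => -[[[]|]|] defF; rewrite defF in Fx.
  - by rewrite -(cone u1 x F1) ?lexx //; left.
  - by rewrite -(cone u1 x F1) ?lexx //; right.
  - by rewrite -(cone u2 x F2) ?lexx ?orbT //; left.
  - by rewrite -(cone u2 x F2) ?lexx ?orbT //; right.
have m_sub x y t : 0 <= t -> m (x + t *: y) <= m x + t * nrm y.
  move=> t0; have H k : `|((x + t *: y) *m M) 0 k| <= `|(x *m M) 0 k| + t * nrm y.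
    rewrite mulmxDl -scalemxAl mxE (le_trans (ler_normD _ _)) // lerD2l mxE normrM.
    rewrite ger0_norm // ler_wpM2l //; case: (ord2P k) => ->.
      by rewrite M0 le1.
    by rewrite M1 le2.
  rewrite /m ge_max !(le_trans (H _)) // lerD2r le_max lexx ?orbT //.
have nrmE x : nrm x = m x.
  apply/eqP; rewrite eq_le le_m andbT; have [->|x0] := eqVneq x 0.
    by rewrite nrm0 /m le_max normr_ge0.
  (* A quarter turn of [x]: [det2 x y] is a sum of two squares, so [x] and [y] form a basis. *)
  pose y : 'rV[R]_2 := \row_i (if i == 0 then - x 0 1 else x 0 0).
  have det_xy : det2 x y != 0.
    rewrite /det2 !mxE /= mulrN opprK -!expr2 paddr_eq0 ?sqr_ge0 // !sqrf_eq0.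
    by apply: contra x0 => /andP[/eqP x00 /eqP x01]; apply/eqP/row2P; rewrite mxE.
  (* For [t < d] the error [t * nrm y] is at most [e / 2]; it occurs twice, once for [nrm] and once
     for [m]. *)
  apply/ler_addgt0Pr => e e0; pose d := e / (2 * (nrm y + 1)).
  have ny := nrm_ge0 y.
  have d0 : 0 < d by rewrite divr_gt0 // mulr_gt0 // ltr_wpDl.
  have [t [t0 ltd gen_t]] : exists t, [/\ 0 < t, t < d &
      forall i, s i != 0 -> det2 (x + t *: y) (s i) != 0].
    have detD t k : det2 (x + t *: y) (s k) = det2 x (s k) + t * det2 y (s k).
      by rewrite /det2 !mxE; ring.
    have near_k k : \forall t \near nbhs ((0 : R)^'+)%classic,
        s k != 0 -> det2 (x + t *: y) (s k) != 0.
      (* If [x] is parallel to [s k], then [y] is not, and every positive [t] is good; otherwise a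
         sufficiently small [t] does not cancel the nonzero determinant. *)
      have [xk0 | xk0] := eqVneq (det2 x (s k)) 0.
        near=> t; rewrite detD xk0 add0r => sk0; apply: mulf_neq0; first by rewrite gt_eqF.
        apply: contra_neq sk0 => yk0; apply: row2P; apply: (mulfI det_xy);
          rewrite !mxE mulr0; move: xk0 yk0; rewrite /det2 !mxE /= => xk0 yk0.
          transitivity (- x 0 0 * (- x 0 1 * s k 0 1 - x 0 0 * s k 0 0)
            - x 0 1 * (x 0 0 * s k 0 1 - x 0 1 * s k 0 0)); first by ring.
          by rewrite xk0 yk0 !mulr0 subrr.
        transitivity (- x 0 1 * (- x 0 1 * s k 0 1 - x 0 0 * s k 0 0)
          + x 0 0 * (x 0 0 * s k 0 1 - x 0 1 * s k 0 0)); first by ring.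
        by rewrite xk0 yk0 !mulr0 addr0.
      have B0 : 0 < `|det2 y (s k)| + 1 by rewrite ltr_wpDl.
      have A0 : 0 < `|det2 x (s k)| / (`|det2 y (s k)| + 1).
        by rewrite divr_gt0 // normr_gt0.
      near=> t; rewrite detD => _; apply/negP; rewrite addrC addr_eq0 => /eqP tB.
      have t0 : 0 < t by [].
      have : t < `|det2 x (s k)| / (`|det2 y (s k)| + 1).
        by near: t; apply: nbhs_right_lt.
      rewrite ltr_pdivlMr // ltNge => /negP[].
      by rewrite -normrN -tB normrM gtr0_norm // ler_pM2l // lerDl.
    have near_t : \forall t \near nbhs ((0 : R)^'+)%classic, [/\ 0 < t, t < d &
      forall k, s k != 0 -> det2 (x + t *: y) (s k) != 0].
      near=> t; split.
      - by [].
      - by near: t; apply: nbhs_right_lt.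
      by near: t; apply: filter_forall.
    by case: (filter_ex near_t) => t tP; exists t.
  have xty0 : x + t *: y != 0.
    apply: contra_neq det_xy => /(congr1 (det2 x)) => e1.
    have : t * det2 x y = 0.
      transitivity (det2 x (x + t *: y)); first by rewrite /det2 !mxE; ring.
      by rewrite e1 /det2 !mxE !mulr0 subrr.
    by move/eqP; rewrite mulf_eq0 gt_eqF //= => /eqP.
  have le_n : nrm x <= nrm (x + t *: y) + t * nrm y.
    rewrite -{1}[x](addrK (t *: y)) (le_trans (nrmD _ _)) // nrmN nrmZ gtr0_norm //.
  apply: le_trans le_n _.
  have := gen_m _ xty0 gen_t; have := m_sub x y t (ltW t0).
  have : t * nrm y <= d * (nrm y + 1) by rewrite ler_pM // ?ltW // ltrDl.
  have -> : d * (nrm y + 1) = e / 2.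
    by rewrite /d invfM mulrA mulfVK // gt_eqF // ltr_wpDl.
  lra.
exists M; split=> //.
- rewrite unitmxE unitfE; apply/det0P => -[x x0 xM]; case/negP: x0; apply/eqP/nrm_eq0.
  by rewrite nrmE /m xM !mxE normr0 maxxx.
- by rewrite defF1; apply/seteqP; split=> x /=; rewrite M0.
- by rewrite defF2; apply/seteqP; split=> x /=; rewrite M1.
Unshelve. all: by end_near.
Qed.

End QuadrilateralNorm.


(** * Derivatives and rigid motions *)

Section Derivatives.
Local Open Scope classical_set_scope.
Variable R : realType.

(** Reduces directional derivatives to derivatives in one real variable. *)
Lemma is_derive_lineP (V W : normedModType R) (f : V -> W) x v df :
  is_derive x v f df <-> is_derive (0 : R) 1 (fun h => f (h *: v + x)) df.
Proof.
have E : 'D_v f x = 'D_1 (fun h : R => f (h *: v + x)) 0.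
  rewrite /derive; set g1 := fun h => h^-1 *: _; set g2 := fun h => h^-1 *: _.
  suff -> : g1 = g2 by [].
  by apply/funext => h; rewrite /g1 /g2 /= addr0 scale0r add0r [_%:A]mulr1.
split=> -[dfx <-]; apply: DeriveDef; rewrite ?E //.
  by move/derivable1P: dfx.
by apply/derivable1P.
Qed.

Lemma is_derive_coord (V : normedModType R) m n (f : V -> 'M[R]_(m, n)) x v df i j :
  is_derive x v f df -> is_derive x v (fun y => f y i j) (df i j).
Proof.
case=> dfx <-; apply: DeriveDef; last by rewrite derive_mx // mxE.
by move/derivable_mxP: dfx.
Qed.

Lemma is_derive_affine (a b : R) : is_derive (0 : R) 1 (fun h => h * a + b) a.
Proof.
have -> : (fun h => h * a + b) = (a \*: (id : R -> R)) + cst b.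
  by apply/funext => h /=; rewrite mulrC.
apply: is_derive_eq.
by rewrite addr0 [RHS](esym (mulr1 a)).
Qed.

Lemma is_derive_dot (V : normedModType R) (f : V -> 'rV[R]_2) x v df m
    (M : 'M[R]_(2, m)) k :
  is_derive x v f df -> is_derive x v (fun y => (f y *m M) 0 k) ((df *m M) 0 k).
Proof.
move=> dfx; have d0 := is_derive_coord 0 0 dfx; have d1 := is_derive_coord 0 1 dfx.
have -> : (fun y => (f y *m M) 0 k) =
    (M 0 k \*: (fun y => f y 0 0)) + (M 1 k \*: (fun y => f y 0 1)).
  by apply/funext => y; rewrite dot2E; congr (_ + _); apply: mulrC.
by apply: is_derive_eq; rewrite dot2E; congr (_ + _); apply: mulrC.
Qed.

(** The difference quotients at [e / 2] and [- (e / 2)] are 1 and -1, and no limit lies at distance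
    less than 1 from both. *)
Lemma norm_not_derivable (c : R) : ~ derivable (fun h : R => c + `|h|) (0 : R) 1.
Proof.
move=> /cvg_ex[/= l /cvgrPdist_lt/(_ 1 ltr01)].
rewrite /dnbhs /within /= => /nbhs_ballP[e /= e0 le].
have he : 0 < e / 2 by rewrite divr_gt0.
have lhe : `|e / 2| < e by rewrite gtr0_norm // ltr_pdivrMr // ltr_pMr // ltr1n.
have := le (e / 2); have := le (- (e / 2)).
rewrite /ball /= !sub0r !normrN => /(_ lhe) H1 /(_ lhe) H2.
have e20 : e / 2 != 0 by rewrite gt_eqF.
have e2N : - (e / 2) != 0 by rewrite oppr_eq0.
move: (H1 e2N) (H2 e20).
rewrite !addr0 !scaler1 normr0 addr0 normrN [c + _]addrC addrK (gtr0_norm he).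
rewrite /GRing.scale /= invrN mulNr mulVf // opprK !ltr_norml.
by case/andP=> _ + /andP[+ _]; lra.
Qed.

End Derivatives.

(** * Local linearity and rigid motions of a maximum norm *)

Section MaxNorm.
Variables (R : realType) (nrm : 'rV[R]_2 -> R) (M : 'M[R]_2).
Hypothesis uM : M \in unitmx.
Hypothesis nrmE : forall x, nrm x = Num.max `|(x *m M) 0 0| `|(x *m M) 0 1|.
Implicit Types (x y d : 'rV[R]_2).

Definition other_coord (k : 'I_2) : 'I_2 := if k == 0 then 1 else 0.

Lemma other_coord_neq k : (other_coord k == k) = false.
Proof. by case: (ord2P k) => ->. Qed.

Lemma nrm_dominant x k : `|(x *m M) 0 (other_coord k)| <= `|(x *m M) 0 k| ->
  nrm x = `|(x *m M) 0 k|.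
Proof.
rewrite nrmE; case: (ord2P k) => ->; rewrite /other_coord /= => le; first exact/max_idPl.
exact/max_idPr.
Qed.

Lemma coord_le_nrm x k : `|(x *m M) 0 k| <= nrm x.
Proof. by rewrite nrmE le_max; case: (ord2P k) => ->; rewrite lexx ?orbT. Qed.

Definition vec_of (a b : R) : 'rV[R]_2 :=
  (\row_i (if i == 0 then a else b)) *m invmx M.

Lemma vec_of0 a b : (vec_of a b *m M) 0 0 = a.
Proof. by rewrite /vec_of mulmxKV // mxE. Qed.

Lemma vec_of1 a b : (vec_of a b *m M) 0 1 = b.
Proof. by rewrite /vec_of mulmxKV // mxE. Qed.

Lemma coord_inj x y : (forall k, (x *m M) 0 k = (y *m M) 0 k) -> x = y.
Proof.
move=> xy; apply: (can_inj (mulmxK uM)); apply/rowP => k; exact: xy.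
Qed.

(** Moving each coordinate by less than half the gap between the absolute values preserves both the
    dominance of coordinate [k] and its sign. *)
Lemma nrm_near_dominant (T : topologicalType) (f : T -> 'rV[R]_2) (t : T) k :
    {for t, continuous (fun s => (f s *m M) 0 k)} ->
    {for t, continuous (fun s => (f s *m M) 0 (other_coord k))} ->
    `|(f t *m M) 0 (other_coord k)| < `|(f t *m M) 0 k| ->
  \forall s \near t, nrm (f s) = Num.sg ((f t *m M) 0 k) * (f s *m M) 0 k.
Proof.
move=> ck co lt_t; set g := (fun s => (f s *m M) 0 k) in ck.
set g' := (fun s => (f s *m M) 0 (other_coord k)) in co.
have gt0 : 0 < (`|g t| - `|g' t|) / 2 by rewrite divr_gt0 // subr_gt0.
move/cvgrPdist_lt: ck => /(_ _ gt0) ck; move/cvgrPdist_lt: co => /(_ _ gt0) co.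
near=> s.
have ks : `|g t - g s| < (`|g t| - `|g' t|) / 2 by near: s.
have os : `|g' t - g' s| < (`|g t| - `|g' t|) / 2 by near: s.
have g't := normr_ge0 (g' t).
rewrite (@nrm_dominant _ k) -/(g s) -/(g t).
  have : g s != 0 /\ Num.sg (g s) = Num.sg (g t).
    have [gs|gs|gs] := ltrgtP (g t) 0.
    - move: ks; rewrite (ltr0_norm gs) ltr_norml => /andP[ks _].
      have gs0 : g s < 0 by lra.
      by rewrite !ltr0_sg ?lt_eqF.
    - move: ks; rewrite (gtr0_norm gs) ltr_norml => /andP[_ ks].
      have gs0 : 0 < g s by lra.
      by rewrite !gtr0_sg ?gt_eqF.
    - by move: lt_t; rewrite -/(g t) gs normr0 ltNge normr_ge0.
  by case=> _ <-; rewrite normrEsg.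
rewrite -/(g' s) -/(g s).
have := ler_distD 0 (g' s) (g' t); rewrite !subr0 => _.
have H1 : `|g' s| <= `|g' t| + `|g' t - g' s|.
  by rewrite distrC; apply: le_trans (ler_normD _ _); rewrite addrC subrK.
have H2 : `|g t| <= `|g s| + `|g t - g s|.
  by apply: le_trans (ler_normD _ _); rewrite addrC subrK.
lra.
Unshelve. all: by end_near.
Qed.

Lemma motion_fieldsP eta : motion_fields nrm eta <-> exists c, eta = fun=> c.
Proof.
split=> [[alpha [calpha alpha0 alpha_iso] dalpha] | [c ->]]; last first.
  exists (fun x t => x + t *: c).
    split=> [x|x|x y t _].
    - apply: continuous_subspaceT => t; apply: cvgD; first exact: cvg_cst.
      by apply: cvgZr_tmp; apply: cvg_id.
    - by rewrite scale0r addr0.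
    - by rewrite opprD addrACA subrr addr0.
  move=> x; have dc : is_derive (0 : R) (1 : R) (fun t : R => t *: c) c.
    apply: DeriveDef; first by apply: diff_derivable; apply: ex_diff.
    by rewrite deriveE ?diff_val ?scale1r //; apply: ex_diff.
  have -> : (fun t => x + t *: c) = cst x + (fun t : R => t *: c) by [].
  by rewrite -[c in is_derive _ _ _ c]add0r; apply: is_deriveD.
have key k x y : `|((x - y) *m M) 0 (other_coord k)| < `|((x - y) *m M) 0 k| ->
    (eta x *m M) 0 k = (eta y *m M) 0 k.
  move=> lt_k; pose f t := alpha x t - alpha y t.
  have f0 : f 0 = x - y by rewrite /f !alpha0.
  have df : is_derive (0 : R) 1 f (eta x - eta y) by apply: is_deriveB.
  have cf j : {for (0 : R), continuous (fun s => (f s *m M) 0 j)}.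
    have [dj _] := is_derive_dot M j df.
    by apply/differentiable_continuous/derivable1_diffP.
  rewrite -f0 in lt_k; have near_f := nrm_near_dominant (cf k) (cf _) lt_k.
  have dk := is_derive_dot M k df.
  have : is_derive (0 : R) (1 : R) (fun s => (f s *m M) 0 k) 0.
    apply: (@near_eq_is_derive _ _ _ (cst ((f 0 *m M) 0 k))).
    near=> t; rewrite /cst.
    have sg0 : Num.sg ((f 0 *m M) 0 k) != 0.
      by rewrite sgr_eq0 -normr_gt0 (le_lt_trans _ lt_k).
    apply: (mulfI sg0); rewrite -(nbhs_singleton near_f).
    have <- : nrm (f t) = nrm (f 0).
      rewrite f0 alpha_iso //; apply: subset_itv_oo_cc; near: t; apply: near_in_itvoo.
      by rewrite in_itv /= ltrN10 ltr01.
    by near: t.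
  move=> [_ d0]; case: dk => _; rewrite d0 mulmxBl !mxE => /esym/eqP.
  by rewrite subr_eq0 => /eqP.
exists (eta 0); apply/funext => x; apply: coord_inj => k.
pose xk := (x *m M) 0 k; pose xo := (x *m M) 0 (other_coord k).
pose B := 1 + `|xk| + `|xo|.
(* The intermediate point: it differs from [x] in coordinate [k] only, and [B] is so large that
   coordinate [k] also dominates in [z - 0]. *)
pose z : 'rV[R]_2 := (\row_i (if i == k then xk + B else xo)) *m invmx M.
have zk : (z *m M) 0 k = xk + B by rewrite mulmxKV // mxE eqxx.
have zo : (z *m M) 0 (other_coord k) = xo by rewrite mulmxKV // mxE other_coord_neq.
have B0 : 0 < B by rewrite /B -addrA ltr_pwDl // addr_ge0.
transitivity ((eta z *m M) 0 k); apply: key.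
  rewrite mulmxBl mxE [X in _ + X]mxE zo subrr normr0 normr_gt0.
  by rewrite mxE [X in _ + X]mxE zk opprD addrA subrr add0r oppr_eq0 gt_eqF.
rewrite subr0 zk zo (lt_le_trans _ (ler_norm _)) // /B.
by have := ler_norm (- xk); rewrite normrN; lra.
Unshelve. all: by end_near.
Qed.

End MaxNorm.

(** * The differential of the rigidity map *)

Section Vertices.
Variables (K : pzRingType) (V : finType).
Implicit Types (x y : 'M[K]_(#|V|, 2)) (v w : V).

Lemma at_vertexD x y v : at_vertex (x + y) v = at_vertex x v + at_vertex y v.
Proof. exact: linearD. Qed.

Lemma at_vertexZ a x v : at_vertex (a *: x) v = a *: at_vertex x v.
Proof. exact: linearZ. Qed.

Lemma at_vertex0 v : at_vertex (0 : 'M[K]_(#|V|, 2)) v = 0.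
Proof. exact: linear0. Qed.

Lemma at_vertex_inj x y : (forall v, at_vertex x v = at_vertex y v) -> x = y.
Proof.
by move=> xy; apply/row_matrixP => i; rewrite -(enum_valK i) [LHS]xy.
Qed.

Definition configuration (f : V -> 'rV[K]_2) : 'M[K]_(#|V|, 2) :=
  \matrix_(i < #|V|) f (enum_val i).

Lemma at_configuration f v : at_vertex (configuration f) v = f v.
Proof. by rewrite /at_vertex rowK enum_rankK. Qed.

End Vertices.

Lemma set2_eq (T : finType) (a b c d : T) : [set a; b]%SET = [set c; d]%SET ->
  (a = c /\ b = d) \/ (a = d /\ b = c).
Proof.
move=> E; have : a \in [set c; d]%SET by rewrite -E set21.
have : b \in [set c; d]%SET by rewrite -E set22.
have : c \in [set a; b]%SET by rewrite E set21.
have : d \in [set a; b]%SET by rewrite E set22.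
rewrite !inE => /orP[]/eqP h1 /orP[]/eqP h2 /orP[]/eqP h3 /orP[]/eqP h4;
by [left; split; congruence | right; split; congruence].
Qed.

Section Differential.
Variables (R : realType) (nrm : 'rV[R]_2 -> R) (M : 'M[R]_2).
Hypothesis nrm_norm : is_norm nrm.
Hypothesis uM : M \in unitmx.
Hypothesis nrmE : forall x, nrm x = Num.max `|(x *m M) 0 0| `|(x *m M) 0 1|.
Variables (V : finType) (E : {set {set V}}) (p : 'M[R]_(#|V|, 2)).
Hypothesis bar_joint : bar_joint_framework E p.
Hypothesis wpos : well_positioned nrm E p.

Lemma edge_lengthE (x : 'M[R]_(#|V|, 2)) v w :
  edge_length nrm x [set v; w]%SET = nrm (at_vertex x v - at_vertex x w).
Proof.
rewrite /edge_length; case: pickP => [[a b] /= /eqP/set2_eq|/(_ (v, w))/=].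
  by case=> -[-> ->] //; rewrite -opprB (nrmN nrm_norm).
by rewrite eqxx.
Qed.

Lemma edge_neq v w : [set v; w]%SET \in E -> v != w.
Proof. by move/(proj1 bar_joint); rewrite cards2; case: eqVneq. Qed.

Lemma edge_vec_neq0 v w : [set v; w]%SET \in E -> at_vertex p v - at_vertex p w != 0.
Proof.
move/edge_neq; rewrite subr_eq0; apply: contra_neq; exact: (proj2 bar_joint).
Qed.

(** Each component of the differential is a one-variable derivative of the edge length along the
    line through [p] with direction [x]. *)
Lemma edge_is_derive v w (i : 'I_#|E|) x : enum_val i = [set v; w]%SET ->
  is_derive (0 : R) 1 (fun h => nrm ((at_vertex p v - at_vertex p w) +
     h *: (at_vertex x v - at_vertex x w))) ('d (rigidity_map nrm E) p x 0 i).
Proof.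
move=> ei; have dp : is_derive p x (rigidity_map nrm E) ('d (rigidity_map nrm E) p x).
  by rewrite -deriveE //; apply/derivableP/diff_derivable.
move/is_derive_lineP: (is_derive_coord 0 i dp).
have -> // : (fun h : R => rigidity_map nrm E (h *: x + p) 0 i) =
  (fun h : R => nrm (at_vertex p v - at_vertex p w +
     h *: (at_vertex x v - at_vertex x w))).
apply/funext => h; rewrite mxE ei edge_lengthE !at_vertexD !at_vertexZ.
by rewrite opprD addrACA -scalerBr addrC.
Qed.

Definition edge_vec v w := at_vertex p v - at_vertex p w.

(** A tie would contradict differentiability: if one end moves so that one absolute coordinate grows
    while the other shrinks, the length has a kink. *)
Lemma edge_coords_neq v w : [set v; w]%SET \in E ->
  `|(edge_vec v w *m M) 0 0| != `|(edge_vec v w *m M) 0 1|.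
Proof.
move=> eE; apply/eqP => ab; set a := _ 0 0 in ab; set b := _ 0 1 in ab.
have nvw := edge_neq eE.
(* Along this direction the length of the edge is |a| + |h|. *)
have b0 : b != 0.
  apply: contra_neq (edge_vec_neq0 eE) => b0.
  by apply: (nrm_eq0 nrm_norm); rewrite nrmE -/a -/b ab b0 normr0 maxxx.
have a0 : a != 0 by rewrite -normr_eq0 ab normr_eq0.
pose x := configuration (fun u => if u == v then vec_of M (Num.sg a) (- Num.sg b) else 0).
have xv : at_vertex x v - at_vertex x w = vec_of M (Num.sg a) (- Num.sg b).
  by rewrite !at_configuration eqxx eq_sym (negPf nvw) subr0.
have [dx _] := edge_is_derive x (enum_rankK_in eE eE).
apply: (@norm_not_derivable R `|a|); move: dx; rewrite xv.
set f := (fun h => _); set g := (fun h => _); suff -> : f = g by [].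
apply/funext => h; rewrite /f /g nrmE mulmxDl -scalemxAl.
rewrite mxE [X in _ + X]mxE vec_of0 // [X in Num.max _ `|X|]mxE.
rewrite [X in Num.max _ `|_ + X|]mxE vec_of1 // -/(edge_vec v w) -/a -/b.
have -> : a + h * Num.sg a = Num.sg a * (`|a| + h).
  by rewrite mulrDr -numEsg mulrC.
have -> : b + h * - Num.sg b = Num.sg b * (`|a| - h).
  by rewrite ab mulrBr -numEsg mulrN mulrC.
rewrite !normrM !normr_sg a0 b0 !mul1r.
have := normr_ge0 a; set A := `|a| => A0.
have [h0 | h0] := ger0P h; first rewrite ger0_norm ?addr_ge0 //.
  by apply/max_idPl; rewrite ler_norml; lra.
rewrite [X in Num.max _ X]ger0_norm; last by lra.
by apply/max_idPr; rewrite ler_norml; lra.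
Qed.

(** Boolean form of the framework colour belonging to the facet where coordinate [k] equals 1;
    [framework_colourP] relates the two. *)
Definition coloured (k : 'I_2) v w := nrm (edge_vec v w) == `|(edge_vec v w *m M) 0 k|.

Lemma edge_vecC v w : edge_vec w v = - edge_vec v w.
Proof. by rewrite /edge_vec opprB. Qed.

Lemma colouredC k v w : coloured k v w = coloured k w v.
Proof. by rewrite /coloured edge_vecC (nrmN nrm_norm) mulNmx mxE normrN. Qed.

Lemma coloured_lt k v w : [set v; w]%SET \in E -> coloured k v w ->
  `|(edge_vec v w *m M) 0 (other_coord k)| < `|(edge_vec v w *m M) 0 k|.
Proof.
move=> eE /eqP ck; rewrite lt_neqAle -ck (coord_le_nrm nrmE) andbT ck.
by have := edge_coords_neq eE; case: (ord2P k) => -> //; rewrite eq_sym.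
Qed.

Lemma coloured_other k v w : [set v; w]%SET \in E ->
  coloured (other_coord k) v w = ~~ coloured k v w.
Proof.
move=> eE; apply/idP/idP => [co|].
  apply/negP => /(coloured_lt eE); move/(coloured_lt eE): co.
  have -> : other_coord (other_coord k) = k by case: (ord2P k) => ->.
  by move=> /lt_trans h /h; rewrite ltxx.
rewrite /coloured nrmE; case: (ord2P k) => ->; rewrite /other_coord /=;
  by case: (leP `|(edge_vec v w *m M) 0 0| `|(edge_vec v w *m M) 0 1|); rewrite ?eqxx.
Qed.

(** Coordinate [k] dominates strictly by [coloured_lt], so near [p] the length is this coordinate
    times a constant sign, which is affine along every line. *)
Lemma differentialE k v w (i : 'I_#|E|) x : enum_val i = [set v; w]%SET -> coloured k v w ->
  'd (rigidity_map nrm E) p x 0 i =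
  Num.sg ((edge_vec v w *m M) 0 k) *
    ((at_vertex x v - at_vertex x w) *m M) 0 k.
Proof.
move=> ei ck; have eE : [set v; w]%SET \in E by rewrite -ei enum_valP.
set d := at_vertex x v - at_vertex x w.
have aff j : (fun h : R => ((edge_vec v w + h *: d) *m M) 0 j) =
    (fun h => h * (d *m M) 0 j + (edge_vec v w *m M) 0 j).
  apply/funext => h; rewrite mulmxDl -scalemxAl mxE addrC; congr (_ + _).
  by rewrite mxE.
have lin j : is_derive (0 : R) 1 (fun h : R => ((edge_vec v w + h *: d) *m M) 0 j) ((d *m M) 0 j).
  by rewrite aff; apply: is_derive_affine.
have cont j : {for (0 : R), continuous (fun h : R => ((edge_vec v w + h *: d) *m M) 0 j)}.
  by have [dj _] := lin j; apply/differentiable_continuous/derivable1_diffP.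
have lt_k := coloured_lt eE ck.
have near0 := nrm_near_dominant nrmE (cont k) (cont (other_coord k)).
rewrite scale0r addr0 in near0; have {}near0 := near0 lt_k.
have [_ <-] := edge_is_derive x ei; rewrite -/(edge_vec v w) -/d.
rewrite (near_eq_derive _ near0).
have [dk dkE] := lin k; rewrite -[in RHS]dkE.
exact: deriveZ.
Qed.

(** The sign of coordinate [k] decides which of the two opposite edge vectors lies in the cone. *)
Lemma framework_colourP (F : set 'rV[R]_2) k v w :
  F = [set x | nrm x <= 1 /\ (x *m M) 0 k = 1]%classic ->
  [set v; w]%SET \in E -> framework_colour nrm p F [set v; w]%SET <-> coloured k v w.
Proof.
move=> FE eE.
have coneE x : x != 0 -> facet_cone nrm F x <-> (x *m M) 0 k = nrm x.
  move=> x0; have nx0 := nrm_gt0 nrm_norm x0; rewrite /facet_cone FE /=.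
  rewrite (nrmZ nrm_norm) ger0_norm ?invr_ge0 ?(nrm_ge0 nrm_norm) // mulVf ?gt_eqF //.
  rewrite -scalemxAl mxE; split=> [[_ [_ /(congr1 ( *%R (nrm x)))]]|->].
    by rewrite mulVKf ?gt_eqF // mulr1.
  by rewrite mulVf ?gt_eqF.
have cone2 a b : [set a; b]%SET \in E ->
    (facet_cone nrm F (at_vertex p a - at_vertex p b) \/
     facet_cone nrm F (at_vertex p b - at_vertex p a)) <-> coloured k a b.
  move=> abE; have ba : at_vertex p b - at_vertex p a = - edge_vec a b by rewrite opprB.
  have eN : ((- edge_vec a b) *m M) 0 k = - (edge_vec a b *m M) 0 k.
    by rewrite mulNmx mxE.
  have ab0 := edge_vec_neq0 abE.
  rewrite ba -/(edge_vec a b) !coneE ?oppr_eq0 // (nrmN nrm_norm) eN /coloured.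
  split=> [[]|/eqP->].
  - by move=> h; rewrite -h ger0_norm // h (nrm_ge0 nrm_norm).
  - by move=> h; rewrite -normrN -h ger0_norm // h (nrm_ge0 nrm_norm).
  - by have [] := ger0P ((edge_vec a b *m M) 0 k); [left | right].
split=> [[a [b [ab /cone2]]] | vwc].
  rewrite -ab => /(_ eE); case: (set2_eq ab) => -[-> ->] //.
  by rewrite colouredC.
by exists v, w; split=> //; apply/cone2.
Qed.

End Differential.

(** * Walks and cycles in gain graphs *)

Section Walks.
Local Open Scope set_scope.
Variable H : gain_graph.
Implicit Types (D C : {set gedge H}) (u w : gvert H) (s : seq (gedge H * gvert H)).

(** The axioms of an undirected multigraph, which the record [gain_graph] does not impose: an edge
    has at most one unordered pair of ends. *)
Definition proper_joins :=
  (forall (e : gedge H) u w, joins e u w = joins e w u) /\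
  (forall (e : gedge H) u w u' w', joins e u w -> joins e u' w' ->
     (u = u' /\ w = w') \/ (u = w' /\ w = u')).

Fixpoint walk D u s :=
  if s is (e, w) :: s' then [&& e \in D, joins e u w & walk D w s'] else true.

Definition walk_end u s := last u (map snd s).

Hypothesis joinsP : proper_joins.

Lemma joinsC (e : gedge H) u w : joins e u w = joins e w u.
Proof. by case: joinsP. Qed.

Lemma joins_ends (e : gedge H) u w u' w' : joins e u w -> joins e u' w' ->
  (u = u' /\ w = w') \/ (u = w' /\ w = u').
Proof. by case: joinsP => _; apply. Qed.

Lemma connect_adjC D : connect_sym (adjacent D).
Proof.
by apply: sym_connect_sym => u w; apply: eq_existsb => e; rewrite joinsC.
Qed.

Lemma adjacentI D (e : gedge H) u w : e \in D -> joins e u w -> adjacent D u w.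
Proof. by move=> eD euw; apply/existsP; exists e; rewrite eD. Qed.

Lemma connect_adjS D D' u w :
  D \subset D' -> connect (adjacent D) u w -> connect (adjacent D') u w.
Proof.
move=> sDD'; apply: connect_sub => x y /existsP[e /andP[eD exy]].
by apply/connect1/(@adjacentI _ e) => //; apply: (fintype.subsetP sDD').
Qed.

Lemma walk_connect D u s : walk D u s -> connect (adjacent D) u (walk_end u s).
Proof.
elim: s u => [|[e w] s IHs] u /=; first by rewrite connect0.
by case/and3P=> eD euw /IHs; apply/connect_trans/connect1/(adjacentI eD).
Qed.

Lemma walk_connect_mem D u s w :
  walk D u s -> w \in u :: map snd s -> connect (adjacent D) u w.
Proof.
elim: s u => [|[e x] s IHs] u /=; first by rewrite inE => _ /eqP->; rewrite connect0.
case/and3P=> eD eux ws; rewrite inE => /orP[/eqP->|ws']; first by rewrite connect0.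
by apply: connect_trans (IHs x ws ws'); apply/connect1/(adjacentI eD).
Qed.

Lemma walk_edges_sub D u s e : walk D u s -> e \in map fst s -> e \in D.
Proof.
elim: s u => [|[f w] s IHs] u //= /and3P[fD _ ws].
by rewrite inE => /orP[/eqP-> // | /(IHs _ ws)].
Qed.

Lemma walkS D D' u s : D \subset D' -> walk D u s -> walk D' u s.
Proof.
move=> sDD'; elim: s u => [|[f w] s IHs] u //= /and3P[fD -> /IHs->].
by rewrite (fintype.subsetP sDD').
Qed.

Lemma path_walk D u p : path (adjacent D) u p ->
  exists2 s, walk D u s & map snd s = p.
Proof.
elim: p u => [|w p IHp] u /=; first by exists [::].
case/andP=> /existsP[e /andP[eD euw]] /IHp[s ws <-].
by exists ((e, w) :: s); rewrite //= eD euw.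
Qed.

Lemma connect_walk D u w : connect (adjacent D) u w ->
  exists2 s, walk D u s & walk_end u s = w /\ uniq (u :: map snd s).
Proof.
case/connectP=> p0 /shortenP[p /path_walk[s ws <-] Up _] ->.
by exists s.
Qed.

Lemma walk_edge_end D u s e x y : walk D u s -> e \in map fst s ->
  joins e x y -> x \in u :: map snd s.
Proof.
elim: s u => [|[f w] s IHs] u //= /and3P[_ fuw ws].
rewrite inE => /orP[/eqP-> fxy | es exy].
  by rewrite !inE; case: (joins_ends fxy fuw) => -[-> _]; rewrite eqxx ?orbT.
by rewrite inE (IHs w) ?orbT.
Qed.

Lemma walk_edges_uniq D u s :
  walk D u s -> uniq (u :: map snd s) -> uniq (map fst s).
Proof.
elim: s u => [|[f w] s IHs] u //= /and3P[_ fuw ws] /andP[uNs Us].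
rewrite (IHs w) // andbT; apply/negP => /(walk_edge_end ws)/(_ fuw).
exact/negP.
Qed.

Lemma walk_nth D u s e x i : walk D u s -> (i < size s)%N ->
  joins (nth e (map fst s) i) (nth x (u :: map snd s) i) (nth x (map snd s) i).
Proof.
elim: s u i => [|[f w] s IHs] u [|i] //= /and3P[_ fuw ws] //.
exact: IHs.
Qed.

(** Closing a simple walk by one more edge; the empty walk is closed by a loop. *)
Lemma walk_cycle D u s e : walk D u s -> uniq (u :: map snd s) ->
  e \notin map fst s -> joins e (walk_end u s) u ->
  is_cycle (e |: [set x in map fst s]).
Proof.
move=> ws Us eNs eu; set V := u :: map snd s; set E := rcons (map fst s) e.
have UE : uniq E by rewrite rcons_uniq eNs (walk_edges_uniq ws).
have sV : size V = (size s).+1 by rewrite /= size_map.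
have sE : size E = (size s).+1 by rewrite size_rcons size_map.
exists (size s), (fun i => nth u V i), (fun i => nth e E i); split.
- move=> i j /eqP; rewrite nth_uniq ?sV // => /eqP; exact: val_inj.
- move=> i j /eqP; rewrite nth_uniq ?sE // => /eqP; exact: val_inj.
- apply/setP => x; rewrite !inE -in_cons -mem_rcons -/E.
  apply/idP/imsetP => [xE | [i _ ->]]; last by rewrite mem_nth ?sE.
  have xlt : (index x E < (size s).+1)%N by rewrite -sE index_mem.
  by exists (Ordinal xlt); rewrite //= nth_index.
move=> i; have -> : ordS i = (i.+1 %% (size s).+1)%N :> nat by [].
rewrite /E nth_rcons size_map.
(* The last index belongs to the closing edge [e], where [ordS] wraps round to the start [u]. *)
have := ltn_ord i; rewrite ltnS leq_eqVlt => /orP[/eqP is' | ilt].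
  rewrite is' ltnn eqxx modnn [nth u V 0]/=.
  by move: eu; rewrite /walk_end (last_nth u) size_map.
by rewrite ilt modn_small ?ltnS //= (walk_nth e u ws).
Qed.

(** Opens the cycle at [e]: the indices [idx n] start just after that of [e] and come back to it
    after [k] steps. This replaces cyclic indexing by induction along a walk. *)
Lemma cycle_walk C e : is_cycle C -> e \in C -> exists u s,
  [/\ walk (C :\ e) u s, uniq (u :: map snd s), joins e (walk_end u s) u
    & C = e |: [set x in map fst s]].
Proof.
case=> k [v [ed [v_inj ed_inj -> jv]]] /imsetP[j _ ->].
pose idx n := iter n (@ordS k.+1) (ordS j).
have validx n : idx n = ((j.+1 + n) %% k.+1)%N :> nat.
  elim: n => [|n IHn] /=; first by rewrite addn0.
  by rewrite IHn -addn1 modnDml addn1 addnS.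
have idx_inj m n : (m <= k)%N -> (n <= k)%N -> idx m = idx n -> m = n.
  move=> lem len /(congr1 (@nat_of_ord _)); rewrite !validx => /eqP.
  by rewrite eqn_modDl !modn_small ?ltnS // => /eqP.
have idxk : idx k = j.
  by apply: val_inj; rewrite /= validx addSnnS modnDr modn_small.
pose st n := (ed (idx n), v (idx n.+1)).
have Uv : uniq (v (idx 0) :: map snd (mkseq st k)).
  rewrite -map_comp -/(mkseq _ _).
  have -> : v (idx 0) :: mkseq (snd \o st) k = mkseq (v \o idx) k.+1.
    rewrite /mkseq /= (iotaDl 1 0) -map_comp //.
  rewrite map_inj_in_uniq ?iota_uniq // => m n.
  by rewrite !mem_iota !add0n !ltnS /= => lem len /v_inj/idx_inj; apply.
have edCj n : (n < k)%N -> ed (idx n) \in [set ed i | i : 'I_k.+1] :\ ed j.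
  move=> ltnk; rewrite !inE imset_f // andbT -idxk; apply/eqP => /ed_inj.
  by move/idx_inj => /(_ (ltnW ltnk) (leqnn _)) eqnk; rewrite eqnk ltnn in ltnk.
have wst m n : (m + n <= k)%N ->
    walk ([set ed i | i : 'I_k.+1] :\ ed j) (v (idx m)) (map st (iota m n)).
  elim: n m => [|n IHn] m //= lemn; rewrite edCj /=; last first.
    by apply: leq_trans lemn; rewrite -addSnnS leq_addr.
  by rewrite jv /= -[ordS _]/(idx m.+1) IHn // addSnnS.
have Est : map fst (mkseq st k) = map (ed \o idx) (iota 0 k) by rewrite -map_comp.
have vend : walk_end (v (idx 0)) (mkseq st k) = v j.
  rewrite -idxk /walk_end -map_comp; case: (k) => // k'.
  by rewrite -addn1 iotaD map_cat last_cat /= add0n addn1.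
exists (v (idx 0)), (mkseq st k); split=> //; first exact: wst.
  by rewrite vend jv.
apply/setP => x; rewrite !inE Est; apply/imsetP/idP => [[i _ ->]|].
  have [-> | neij] := eqVneq i j; first by rewrite eqxx.
  suff [n ltnk <-] : exists2 n, (n < k)%N & idx n = i.
    by apply/orP; right; apply/mapP; exists n; rewrite // mem_iota.
  (* An injection of a finite set into itself is onto, so the walk meets every edge other than
     [e]. *)
  have idx_injo : injective (fun n : 'I_k.+1 => idx n).
    by move=> m n /idx_inj eqmn; apply/val_inj/eqmn; rewrite -ltnS.
  have /codomP[n def_i] : i \in codom (fun n : 'I_k.+1 => idx n).
    by rewrite (inj_card_onto idx_injo).
  exists n => //; rewrite ltn_neqAle -ltnS ltn_ord andbT.
  by apply: contraNneq neij => nk; rewrite def_i nk idxk.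
case/orP=> [/eqP-> | /mapP[n _ ->]]; first by exists j.
by exists (idx n).
Qed.

End Walks.

(** * Potentials *)

Section Potentials.
Local Open Scope set_scope.
Variables (K : fieldType) (H : gain_graph) (eps : gedge H -> K).
Implicit Types (D C : {set gedge H}) (u w : gvert H) (F : gvert H -> K).
Implicit Types (s : seq (gedge H * gvert H)).

Definition potential D F :=
  forall e u w, e \in D -> joins e u w -> F u = eps e * F w.

(* By linearity, independence means that the map sending F to its defects
   F u - eps e * F w on the edges e of D is onto. *)
Definition independent D := forall e, e \in D -> exists F, potential (D :\ e) F /\
  exists u w, joins e u w /\ F u <> eps e * F w.

Hypothesis joinsP : proper_joins H.
Hypothesis eps_sqr : forall e, eps e * eps e = 1.

Lemma eps_neq0 e : eps e != 0.
Proof.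
apply/eqP => e0; have := eps_sqr e; rewrite e0 mul0r => /eqP.
by rewrite eq_sym oner_eq0.
Qed.

(** Since [eps e] is its own inverse, the equation of an edge may be read from either end. *)
Lemma epsK e x y : x = eps e * y -> y = eps e * x.
Proof. by move=> ->; rewrite mulrA eps_sqr mul1r. Qed.

Lemma potentialS D D' F : D \subset D' -> potential D' F -> potential D F.
Proof. by move=> sDD' pF e u w /(fintype.subsetP sDD'); apply: pF. Qed.

Lemma potentialD1 D e u w F : joins e u w -> F u = eps e * F w ->
  potential (D :\ e) F -> potential D F.
Proof.
move=> euw Fuw pF f x y fD fxy; have [fe|nfe] := eqVneq f e; last first.
  by apply: pF => //; rewrite !inE nfe.
rewrite fe in fxy *; have [[-> ->] // | [-> ->]] := joins_ends joinsP fxy euw.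
exact: epsK.
Qed.

Lemma potential_walk D u s F : potential D F -> walk D u s ->
  F u = (\prod_(e <- map fst s) eps e) * F (walk_end u s).
Proof.
move=> pF; elim: s u => [|[e w] s IHs] u /=; first by rewrite big_nil mul1r.
case/and3P=> eD euw ws; rewrite (pF e u w) // (IHs w) // big_cons mulrA.
by [].
Qed.

Lemma potential_connect D u w F : potential D F ->
  connect (adjacent D) u w -> (F u == 0) = (F w == 0).
Proof.
move=> pF /connect_walk[s ws [<- _]]; rewrite (potential_walk pF ws) mulf_eq0.
suff /negPf-> : \prod_(e <- map fst s) eps e != 0 by [].
by rewrite prodf_seq_neq0; apply/allP => e _; apply/implyP => _; apply: eps_neq0.
Qed.

Lemma prod_setU1_seq D u s (e : gedge H) : walk D u s -> uniq (u :: map snd s) ->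
    e \notin map fst s ->
  \prod_(f in e |: [set x in map fst s]) eps f =
  eps e * \prod_(f <- map fst s) eps f.
Proof.
move=> ws Us eNs; rewrite big_setU1 ?inE //=; congr (_ * _).
rewrite big_uniq ?(walk_edges_uniq joinsP ws) //.
by apply: eq_bigl => f; rewrite inE.
Qed.

Lemma cycle_edge C : is_cycle C -> exists2 e, e \in C & exists u w, joins e u w.
Proof.
case=> k [v [ed [_ _ -> jv]]]; exists (ed ord0); first exact: imset_f.
by exists (v ord0), (v (ordS ord0)).
Qed.

(** Following [F] along the rest of the cycle multiplies it by the product over the other edges,
    which is [eps e] times the product over [C]. *)
Lemma potential_cycle C e F : is_cycle C -> e \in C -> potential (C :\ e) F ->
  exists u w, joins e w u /\ F u = eps e * (\prod_(f in C) eps f) * F w.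
Proof.
move=> cC eC pF; have [u [s [ws Us eu defC]]] := cycle_walk cC eC.
exists u, (walk_end u s); split=> //; rewrite (potential_walk pF ws).
have eNs : e \notin map fst s.
  by apply/negP => /(walk_edges_sub ws); rewrite !inE eqxx.
by rewrite defC (prod_setU1_seq ws) // mulrA eps_sqr mul1r.
Qed.

(** Going once round the cycle multiplies the value by a factor other than 1, so the value is
    zero. *)
Lemma potential_unbalanced C e x y F : is_cycle C -> \prod_(f in C) eps f <> 1 ->
  potential C F -> e \in C -> joins e x y -> F x = 0.
Proof.
move=> cC nC pF eC exy.
have [u [w [ewu Fu]]] := potential_cycle cC eC (potentialS (subD1set C e) pF).
have Fw : F w = 0.
  apply/eqP/negPn/negP => Fw0; apply: nC; apply: (mulIf Fw0).
  apply: (mulfI (eps_neq0 e)); rewrite mulrA -Fu mul1r; apply: epsK.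
  exact: (pF e).
have Fu0 : F u = 0 by rewrite Fu Fw mulr0.
by have [[-> _] | [-> _]] := joins_ends joinsP exy ewu.
Qed.

Lemma cycle_nonbridge C D e : is_cycle C -> C \subset D -> e \in C ->
  connect (adjacent (D :\ e)) =2 connect (adjacent D).
Proof.
move=> cC sCD eC; have [u [s [ws Us eu defC]]] := cycle_walk cC eC.
have con_uw : connect (adjacent (D :\ e)) u (walk_end u s).
  by apply: walk_connect; apply: walkS ws; apply: finset.setSD.
have con_e x y : joins e x y -> connect (adjacent (D :\ e)) x y.
  case/(joins_ends joinsP eu) => -[<- <-]; rewrite // (connect_adjC joinsP) //.
move=> x y; apply/idP/idP; first by apply: connect_adjS; apply: subD1set.
apply: connect_sub => {}x {}y /existsP[f /andP[fD fxy]].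
have [fe|nfe] := eqVneq f e; first by apply: con_e; rewrite -fe.
by apply/connect1/(@adjacentI _ _ f); rewrite // !inE nfe.
Qed.

Lemma connect_cycle D e u w : e \in D -> joins e u w ->
  connect (adjacent (D :\ e)) u w -> exists2 C, cycle_of D C & e \in C.
Proof.
move=> eD euw /connect_walk[s ws [es Us]].
exists (e |: [set x in map fst s]); last by rewrite !inE eqxx.
split; first apply: (walk_cycle joinsP ws Us).
- by apply/negP => /(walk_edges_sub ws); rewrite !inE eqxx.
- by rewrite es (joinsC joinsP).
rewrite finset.subUset finset.sub1set eD; apply/fintype.subsetP => f; rewrite inE.
by move/(walk_edges_sub ws); rewrite !inE => /andP[].
Qed.

Lemma cycle_ofS D D' C : D \subset D' -> cycle_of D C -> cycle_of D' C.
Proof. by move=> sDD' [cC sCD]; split=> //; apply: fintype.subset_trans sDD'. Qed.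

(** Induction on the number of edges. If the ends of the new edge [e] are already connected, [e]
    closes a balanced cycle and its equation holds; otherwise the potential is rescaled on the
    component of one end. *)
Lemma potential_exists D : (forall C, cycle_of D C -> \prod_(e in C) eps e = 1) ->
  exists2 F, potential D F & forall u, F u != 0.
Proof.
have [n] := ubnP #|D|; elim: n D => // n IHn D leDn balD.
have [D0 | [e eD]] := set_0Vmem D.
  exists (fun=> 1) => [e u w|u]; last exact: oner_neq0.
  by rewrite D0 inE.
have sDe := subD1set D e.
have [||F pF F0] := IHn (D :\ e).
- by rewrite (cardsD1 e D) eD add1n ltnS in leDn.
- by move=> C /(cycle_ofS sDe)/balD.
have [/existsP[u /existsP[w euw]] | Ne] := boolP [exists u, exists w, joins e u w];
    last first.
  exists F => // f x y fD fxy; apply: pF => //; rewrite !inE fD andbT.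
  apply: contraNneq Ne => <-; apply/existsP; exists x; apply/existsP; exists y.
  exact: fxy.
have [con_uw | ncon_uw] := boolP (connect (adjacent (D :\ e)) u w).
  exists F => //; apply: (potentialD1 euw) => //.
  have [C [cC sCD] eC] := connect_cycle eD euw con_uw.
  have pFC : potential (C :\ e) F by apply: potentialS pF; apply: finset.setSD.
  have [x [y [eyx Fx]]] := potential_cycle cC eC pFC.
  rewrite (balD C) // mulr1 in Fx.
  have [[-> ->] | [-> ->]] := joins_ends joinsP euw eyx; last by [].
  exact: epsK.
(* The factor for which [c * F u = eps e * F w], the equation of [e]. *)
pose c := eps e * F w / F u.
have c0 : c != 0 by rewrite !mulf_neq0 ?invr_eq0 ?eps_neq0.
exists (fun x => if connect (adjacent (D :\ e)) u x then c * F x else F x).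
  apply: (potentialD1 euw); first by rewrite /= connect0 (negPf ncon_uw) mulfVK.
  move=> f x y fD fxy.
  have -> : connect (adjacent (D :\ e)) u x = connect (adjacent (D :\ e)) u y.
    by apply: same_connect_r; [apply: connect_adjC | exact: connect1 (adjacentI _ fxy)].
  by rewrite (pF f x y) //; case: ifP; rewrite // mulrCA.
by move=> x; case: ifP => _; [apply: mulf_neq0 | apply: F0].
Qed.

(** [potential_exists] is applied to the edges with all ends in the component of [u], and the result
    is extended by zero; no edge leaves the component. *)
Lemma component_potential D u :
    (forall C, cycle_of D C -> in_component D u C -> \prod_(e in C) eps e = 1) ->
  exists2 F, potential D F &
    forall w, (F w != 0) = connect (adjacent D) u w.
Proof.
move=> balu; pose D' := [set e in D | [forall x, forall y,
  joins e x y ==> connect (adjacent D) u x]].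
have [|F pF F0] := @potential_exists D'.
  move=> C [cC sCD']; apply: balu.
    split=> //; apply: fintype.subset_trans sCD' _; apply/fintype.subsetP=> e.
    by rewrite inE; case/andP.
  move=> e x y eC exy; have := fintype.subsetP sCD' e eC; rewrite inE.
  by case/andP=> _ /forallP/(_ x)/forallP/(_ y)/implyP; apply.
exists (fun x => if connect (adjacent D) u x then F x else 0) => [e x y eD exy|w].
  have conxy : connect (adjacent D) u x = connect (adjacent D) u y.
    by apply: same_connect_r; [apply: connect_adjC | exact: connect1 (adjacentI _ exy)].
  rewrite -conxy; case: ifP => [cux|]; last by rewrite mulr0.
  apply: pF => //; rewrite inE eD; apply/forallP => a; apply/forallP => b.
  apply/implyP => eab; have [[-> _] | [-> _]] := joins_ends joinsP eab exy => //.
  by rewrite -conxy.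
by case: ifP; rewrite ?F0 ?eqxx.
Qed.

End Potentials.

(** * Map graphs characterised by potentials *)

Section PotentialTheorems.
Local Open Scope set_scope.
Variables (K : fieldType) (H : gain_graph) (eps : gedge H -> K).
Implicit Types (D C : {set gedge H}) (u w : gvert H) (F : gvert H -> K).
Hypothesis joinsP : proper_joins H.
Hypothesis eps_sqr : forall e, eps e * eps e = 1.

(** On a balanced cycle the equations of all edges but one imply the remaining one. *)
Lemma independent_cycle D C : independent eps D -> cycle_of D C ->
  \prod_(e in C) eps e <> 1.
Proof.
move=> indD [cC sCD]; have [e eC _] := cycle_edge cC.
have [F [pF [u [w [euw Fuw]]]]] := indD e (fintype.subsetP sCD e eC).
move=> C1; apply: Fuw; have pFC : potential eps (C :\ e) F.
  by apply: potentialS pF; apply: finset.setSD.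
have [x [y [eyx Fx]]] := potential_cycle joinsP eps_sqr cC eC pFC.
rewrite C1 mulr1 in Fx.
have [[-> ->] | [-> ->]] := joins_ends joinsP euw eyx; last by [].
exact: epsK.
Qed.

(* An edge of C1 outside C2 is not a bridge; so a potential whose only defect is
   at this edge vanishes on the component, because it vanishes on C2. *)
Lemma independent_cycle_sub D C1 C2 u : independent eps D ->
  cycle_of D C1 -> in_component D u C1 -> cycle_of D C2 -> in_component D u C2 ->
  C1 \subset C2.
Proof.
move=> indD [cC1 sC1D] uC1 cycC2 uC2; apply/fintype.subsetP => e eC1.
apply/negPn/negP => eNC2.
have [F [pF [x [y [exy Fxy]]]]] := indD e (fintype.subsetP sC1D e eC1).
have [cC2 sC2D] := cycC2; have [f fC2 [a [b fab]]] := cycle_edge cC2.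
have sC2De : C2 \subset D :\ e by rewrite finset.subsetD1 sC2D.
have Fa : F a = 0.
  exact: (potential_unbalanced joinsP eps_sqr cC2 (independent_cycle indD cycC2)
    (potentialS sC2De pF) fC2 fab).
have F0 z : connect (adjacent D) u z -> F z = 0.
  move=> uz; apply/eqP; rewrite -(potential_connect eps_sqr (u := a) pF) ?Fa //.
  rewrite (cycle_nonbridge joinsP cC1 sC1D eC1).
  by apply: connect_trans uz; rewrite (connect_adjC joinsP); apply: uC2 fab.
have Fx : F x = 0 by apply: F0; apply: uC1 eC1 exy.
have Fy : F y = 0 by apply: F0; apply: (uC1 e y x eC1); rewrite (joinsC joinsP).
by apply: Fxy; rewrite Fx Fy mulr0.
Qed.

(** A component with only balanced cycles would carry a nonzero potential, so each has an unbalanced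
    cycle; [independent_cycle_sub], used in both directions, makes it unique. *)
Lemma potential_basis_map_graph D :
  (forall F, potential eps D F -> forall u, F u = 0) -> independent eps D ->
  map_graph D /\ forall C, cycle_of D C -> \prod_(e in C) eps e <> 1.
Proof.
move=> ker0 indD; split=> [u|]; last by move=> C; apply: independent_cycle.
have [C [cC uC _]] : exists C, [/\ cycle_of D C, in_component D u C
    & \prod_(e in C) eps e <> 1].
  apply: contrapT => noC.
  have [|F pF Fu] := @component_potential _ _ eps joinsP eps_sqr D u.
    by move=> C cC uC; apply: contrapT => ?; apply: noC; exists C.
  by have := Fu u; rewrite connect0 ker0 ?eqxx.
exists C; split=> // C' [cC' uC']; apply/eqP; rewrite finset.eqEsubset.
by rewrite !(@independent_cycle_sub D _ _ u).
Qed.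

Lemma cycle_in_component D C e x y u : cycle_of D C -> e \in C -> joins e x y ->
  connect (adjacent D) u x -> in_component D u C.
Proof.
move=> [cC sCD] eC exy ux; have [a [s [ws _ ea defC]]] := cycle_walk cC eC.
have wDs : walk D a s.
  by apply: walkS ws; apply: fintype.subset_trans sCD; apply: subD1set.
have con_z z : z \in a :: map snd s -> connect (adjacent D) a z.
  exact: walk_connect_mem.
have con_x : connect (adjacent D) u a.
  apply: (connect_trans ux); rewrite (connect_adjC joinsP).
  have [[-> _]|[-> _]] := joins_ends joinsP exy ea; last by rewrite connect0.
  exact: walk_connect.
move=> f w z fC fwz; apply: (connect_trans con_x).
move: fC; rewrite {1}defC => /setU1P[fe|]; last first.
  by rewrite inE => fs; apply/con_z/(walk_edge_end joinsP ws fs fwz).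
rewrite fe in fwz; have [[-> _]|[-> _]] := joins_ends joinsP fwz ea.
  exact: walk_connect.
by rewrite connect0.
Qed.

Lemma component_potential_acyclic D u : (forall C, cycle_of D C -> ~ in_component D u C) ->
  exists2 F, potential eps D F & forall w, (F w != 0) = connect (adjacent D) u w.
Proof. by move=> noC; apply: component_potential => // C cC /(noC C cC). Qed.

(** For independence, remove an edge [e]. If its ends stay connected, [e] lies on the only cycle of
    its component; what is left is acyclic and has a potential nonzero at the ends, which cannot
    satisfy the equation of [e] too. If [e] is a bridge, at most one side contains the cycle, and a
    potential supported on the other side has its only defect at [e]. *)
Lemma map_graph_potential_basis D :
    (forall e, exists u w, @joins H e u w) -> map_graph D ->
    (forall C, cycle_of D C -> \prod_(e in C) eps e <> 1) ->
  (forall F, potential eps D F -> forall u, F u = 0) /\ independent eps D.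
Proof.
move=> ends mapD unbD; split=> [F pF u | e eD].
  have [C [[cC uC] _]] := mapD u; have [f fC [a [b fab]]] := cycle_edge (proj1 cC).
  apply/eqP; rewrite (potential_connect eps_sqr pF (uC _ _ _ fC fab)); apply/eqP.
  apply: (potential_unbalanced joinsP eps_sqr (proj1 cC) (unbD C cC) _ fC fab).
  by apply: potentialS pF; case: cC.
have [a [b eab]] := ends e; set D' := D :\ e; have sD'D : D' \subset D := subD1set _ _.
have uniqC u C1 C2 : cycle_of D C1 /\ in_component D u C1 ->
    cycle_of D C2 /\ in_component D u C2 -> C1 = C2.
  by have [C [_ CU]] := mapD u => /CU<- /CU<-.
have comp u C : cycle_of D' C -> in_component D' u C ->
    cycle_of D C /\ in_component D u C.
  move=> /(cycle_ofS sD'D) cC uC; split=> // f w z fC fwz.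
  exact: connect_adjS sD'D (uC f w z fC fwz).
have [con_ab | ncon_ab] := boolP (connect (adjacent D') a b).
  have [Ce cCe eCe] := connect_cycle joinsP eD eab con_ab.
  have [C cC aC | F pF Fa] := @component_potential_acyclic D' a.
    have CeC : Ce = C.
      apply: (uniqC a); last exact: comp.
      by split=> //; apply: (cycle_in_component cCe eCe eab); rewrite connect0.
    by have /fintype.subsetP/(_ e) := proj2 cC; rewrite -CeC !inE eqxx => /(_ eCe).
  exists F; split=> //; exists a, b; split=> // Fab.
  have /negP[] : F a != 0 by rewrite Fa connect0.
  have pDF := potentialD1 joinsP eps_sqr eab Fab pF.
  apply/eqP/(potential_unbalanced joinsP eps_sqr (proj1 cCe) (unbD _ cCe) _ eCe eab).
  by apply: potentialS pDF; case: cCe.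
have [[Ca [cCa aCa]] | NCa] := EM (exists C, cycle_of D' C /\ in_component D' a C);
    last first.
  have [C cC aC | F pF Fa] := @component_potential_acyclic D' a; first by apply: NCa; exists C.
  exists F; split=> //; exists a, b; split=> //.
  have /negPn/eqP-> : ~~ (F b != 0) by rewrite Fa.
  by apply/eqP; rewrite mulr0 Fa connect0.
have ba_con : connect (adjacent D') b a = false.
  by rewrite (connect_adjC joinsP); apply: negbTE.
have [C cC bC | F pF Fb] := @component_potential_acyclic D' b; last first.
  exists F; split=> //; exists a, b; split=> //.
  have /negPn/eqP-> : ~~ (F a != 0) by rewrite Fb ba_con.
  by apply/eqP; rewrite eq_sym mulf_neq0 ?Fb ?connect0 // eps_neq0.
have con_ab : connect (adjacent D) a b by exact: connect1 (adjacentI eD eab).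
have CaC : Ca = C.
  apply: (uniqC a); first exact: comp.
  have [cDC bDC] := comp _ _ cC bC; split=> // f w z fC fwz.
  by apply: (connect_trans con_ab); apply: bDC fwz.
have [f fC [x [y fxy]]] := cycle_edge (proj1 cC).
case/negP: ncon_ab; apply: (@connect_trans _ _ x).
  by apply: aCa fxy; rewrite CaC.
by rewrite (connect_adjC joinsP); apply: bC fxy.
Qed.

End PotentialTheorems.

(** * Trees, and connected spanning map subgraphs *)

Section TreesAndConnectedMapGraphs.
Local Open Scope set_scope.
Variables (K : fieldType) (H : gain_graph).
Implicit Types (D C : {set gedge H}) (u w : gvert H).
Hypothesis joinsP : proper_joins H.

Let one_sqr (e : gedge H) : 1 * 1 = 1 :> K. Proof. exact: mulr1. Qed.

Lemma connected_potential1 D (F : gvert H -> K) u w : connect (adjacent D) u w ->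
  potential (fun=> 1) D F -> F u = F w.
Proof.
move=> /connect_walk[s ws [<- _]] pF.
by rewrite (potential_walk pF ws) big1_eq mul1r.
Qed.

Lemma potential1_indicator D u :
  potential (fun=> 1) D (fun w => (connect (adjacent D) u w)%:R : K).
Proof.
move=> e x y eD exy; rewrite mul1r; congr (_%:R : K); congr nat_of_bool.
by apply: same_connect_r; [apply: connect_adjC | exact: connect1 (adjacentI _ exy)].
Qed.

Lemma potential1_connected D :
  (forall F, potential (fun=> 1 : K) D F -> forall u w, F u = F w) -> connected_graph D.
Proof.
move=> constD u w; have := constD _ (@potential1_indicator D u) u w.
rewrite connect0; case: connect => // /eqP.
by rewrite oner_eq0.
Qed.

(** With all signs 1 every cycle is balanced, so independence excludes cycles. Conversely, deleting
    an edge of a tree separates its ends, and the indicator of one side has its only defect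
    there. *)
Lemma is_treeP D : (forall e, exists u w, @joins H e u w) ->
  is_tree D <->
  (forall F, potential (fun=> 1 : K) D F -> forall u w, F u = F w) /\
  independent (fun=> 1 : K) D.
Proof.
move=> ends; split=> [[conD acyD] | [constD indD]].
  split=> [F pF u w | e eD]; first exact: connected_potential1 (conD u w) pF.
  have [a [b eab]] := ends e; have [con_ab | ncon_ab] :=
    boolP (connect (adjacent (D :\ e)) a b).
    by have [C cC _] := connect_cycle joinsP eD eab con_ab; case: (acyD C).
  exists (fun w => (connect (adjacent (D :\ e)) a w)%:R); split.
    exact: potential1_indicator.
  exists a, b; split=> //; rewrite connect0 (negPf ncon_ab) mul1r.
  by apply/eqP/oner_neq0.
split=> [|C cC]; first exact: potential1_connected.
by apply: (independent_cycle joinsP one_sqr indD cC); rewrite big1_eq.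
Qed.

(* The indicator function of the first vertices of a path has a single defect. *)
Lemma walk_independent D u s : walk D u s -> uniq (u :: map snd s) ->
  independent (fun=> 1 : K) [set e in map fst s].
Proof.
elim: s u => [|[f w] s IHs] u /=; first by move=> _ _ e; rewrite inE.
case/and3P=> fD fuw ws /andP[uNs Us] e.
have fNs : f \notin map fst s.
  by apply/negP => /(walk_edge_end joinsP ws)/(_ fuw); exact/negP.
rewrite !inE => /orP[/eqP-> | es].
  exists (fun x => (x == u)%:R); split; last first.
    exists u, w; split=> //; rewrite eqxx mul1r.
    move: uNs; rewrite inE negb_or eq_sym => /andP[/negPf-> _].
    by apply/eqP/oner_neq0.
  move=> g x y; rewrite !inE mul1r => /andP[/negPf-> /= gs] gxy.
  have xs := walk_edge_end joinsP ws gs gxy.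
  have ys := walk_edge_end joinsP ws gs (etrans (joinsC joinsP g y x) gxy).
  by congr (_%:R); congr nat_of_bool; apply/eqP/eqP => xu; rewrite xu in xs ys *;
     move: uNs; rewrite ?xs ?ys.
have es' : e \in [set e in map fst s] by rewrite inE.
have [F [pF [x [y [exy Fxy]]]]] := IHs w ws Us e es'.
have Fu z : z \in w :: map snd s -> (z == u) = false.
  by move=> zs; apply/eqP => zu; move: uNs; rewrite -zu zs.
have e_ends a b : e \in map fst s -> joins e a b -> (a == u) = false.
  by move=> es2 eab; apply/Fu/(walk_edge_end joinsP ws es2 eab).
(* Giving [u] the value at [w] satisfies the new edge [f]; the other edges do not meet [u]. *)
exists (fun z => if z == u then F w else F z); split; last first.
  exists x, y; split=> //; rewrite (e_ends x y) ?(e_ends y x) //.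
  by rewrite (joinsC joinsP).
move=> g a b; rewrite !inE => /andP[nge /orP[/eqP gf | gs]] gab.
  rewrite gf in gab; rewrite mul1r.
  by have [[-> ->] | [-> ->]] := joins_ends joinsP gab fuw;
    rewrite eqxx Fu ?inE ?eqxx.
rewrite !Fu.
- by apply: (pF g); rewrite ?inE ?nge.
- by apply: (walk_edge_end joinsP ws gs (etrans (joinsC joinsP g b a) gab)).
exact: (walk_edge_end joinsP ws gs gab).
Qed.

(** A cycle minus an edge is a simple path, whose edges are independent for the constant sign 1 and
    so contain no cycle. *)
Lemma cycle_sub_eq C C' : is_cycle C -> is_cycle C' -> C' \subset C -> C' = C.
Proof.
move=> cC cC' sC'C; apply/eqP; rewrite finset.eqEsubset sC'C; apply/fintype.subsetP => e eC.
apply/negPn/negP => eNC'; have [u [s [ws Us _ defC]]] := cycle_walk cC eC.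
have cC's : cycle_of [set x in map fst s] C'.
  split=> //; apply/fintype.subsetP => f fC'.
  have := fintype.subsetP sC'C f fC'; rewrite defC => /setU1P[fe|//].
  by rewrite -fe fC' in eNC'.
apply: (independent_cycle joinsP one_sqr (walk_independent ws Us) cC's).
by rewrite big1_eq.
Qed.

Variable eps : gedge H -> K.
Hypothesis eps_sqr : forall e, eps e * eps e = 1.

(** Take a minimal connected subgraph that still has an unbalanced cycle [C]. Any other cycle would
    have an edge outside [C], and deleting that edge preserves connectedness and [C]; hence [C] is
    the only cycle. *)
Lemma connected_map_graph_exists D :
  ((forall F, potential (fun=> 1 : K) D F -> forall u w, F u = F w) /\
   (forall F, potential eps D F -> forall u, F u = 0)) <->
  exists D', [/\ D' \subset D, connected_graph D', map_graph D' &
    forall C, cycle_of D' C -> \prod_(e in C) eps e <> 1].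
Proof.
split=> [[constD ker0] | [D' [sD'D conD' mapD' unbD']]]; last first.
  split=> F pF u; first by move=> w; apply: connected_potential1 (connect_adjS sD'D (conD' u w)) pF.
  have [C [[cC uC] _]] := mapD' u; have [f fC [a [b fab]]] := cycle_edge (proj1 cC).
  have pD'F := potentialS sD'D pF.
  apply/eqP; rewrite (potential_connect eps_sqr pD'F (uC _ _ _ fC fab)); apply/eqP.
  apply: (potential_unbalanced joinsP eps_sqr (proj1 cC) (unbD' C cC) _ fC fab).
  by apply: potentialS pD'F; case: cC.
(* Without vertices there are no cycles, and the empty subgraph satisfies all conditions
   vacuously. *)
have [[u0 _] | noV] := EM (exists u : gvert H, True); last first.
  exists finset.set0; split; rewrite ?finset.sub0set //.
  - by move=> u; case: noV; exists u.
  - by move=> u; case: noV; exists u.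
  - by move=> C [[k [v _]] _]; case: noV; exists (v ord0).
pose P (D' : {set gedge H}) := `[< connected_graph D' /\ exists2 C, cycle_of D' C
  & \prod_(e in C) eps e <> 1 >].
have PD : P D.
  apply/asboolP; split; first exact: potential1_connected.
  apply: contrapT => noC; have [|F pF F0] := @potential_exists _ _ eps joinsP eps_sqr D.
    by move=> C cC; apply: contrapT => nC; apply: noC; exists C.
  by have := F0 u0; rewrite ker0 ?eqxx.
have [D' /minsetP[/asboolP[conD' [C cC nC]] minD'] sD'D] := minset_exists PD.
have Ceq C' : cycle_of D' C' -> C' = C.
  move=> cC'; apply: cycle_sub_eq; [exact: proj1 cC | exact: proj1 cC' |].
  apply/fintype.subsetP => e eC'; apply/negPn/negP => eNC.
  have eD' := fintype.subsetP (proj2 cC') e eC'.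
  have PD'e : P (D' :\ e).
    apply/asboolP; split.
      by move=> u w; rewrite (cycle_nonbridge joinsP (proj1 cC') (proj2 cC') eC').
    exists C => //; split; first exact: proj1 cC.
    by rewrite finset.subsetD1 eNC (proj2 cC).
  by have /setP/(_ e) := minD' _ PD'e (subD1set _ _); rewrite !inE eqxx eD'.
exists D'; split=> //; last by move=> C' /Ceq->.
move=> u; exists C; split=> [|C' [/Ceq->]//].
by split=> // e w z eC ewz; apply: conD'.
Qed.

End TreesAndConnectedMapGraphs.

(** * Functions on the covering graph *)

Lemma Z2P (g : 'Z_2) : g = 1%g \/ g = neg1.
Proof. by case: g => [[|[|]]] // ?; [left | right]; apply: val_inj. Qed.

Lemma Z2_mulC (g h : 'Z_2) : (g * h = h * g)%g.
Proof. by case: (Z2P g) (Z2P h) => -> [] ->; apply: val_inj. Qed.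

Lemma Z2_mulVV (g : 'Z_2) : (g * g = 1)%g.
Proof. by case: (Z2P g) => ->; apply: val_inj. Qed.

Section Quotient.
Local Open Scope set_scope.
Variables (V : finType) (E : {set {set V}}).
Variable theta : {morphism [set: 'Z_2] >-> {perm V}}.
Hypothesis sym : Z2_symmetric_graph E theta.
Implicit Types (v w : V) (o : qedge E theta) (a b : qvert theta).

Lemma theta1 v : theta 1%g v = v.
Proof. by rewrite morph1 perm1. Qed.

Lemma thetaM g h v : theta g (theta h v) = theta (g * h)%g v.
Proof. by rewrite Z2_mulC morphM ?inE // permM. Qed.

Lemma thetaK g v : theta g (theta g v) = v.
Proof. by rewrite thetaM Z2_mulVV theta1. Qed.

Lemma theta_set1 (e : {set V}) : theta 1%g @: e = e.
Proof. by rewrite -[RHS]imset_id; apply: eq_imset => v; apply: theta1. Qed.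

Lemma theta_setM g h (e : {set V}) : theta g @: (theta h @: e) = theta (g * h)%g @: e.
Proof. by rewrite -imset_comp; apply: eq_imset => v; apply: thetaM. Qed.

Lemma theta_set2 g v w : theta g @: [set v; w] = [set theta g v; theta g w].
Proof. by rewrite imsetU1 imset_set1. Qed.

Lemma theta_neq v : theta neg1 v != v.
Proof.
case: sym => _ _ free; apply/eqP => /free; exact/eqP.
Qed.

Lemma theta_edge g e : e \in E -> theta g @: e \in E.
Proof.
case: sym => _ /(_ g) + _; rewrite inE => /eqP gE eE.
by rewrite -gE; apply: (imset_f (fun e : {set V} => theta g @: e)).
Qed.

Lemma vorbit_in v : vorbit theta v \in [set vorbit theta v | v : V].
Proof. exact: imset_f. Qed.

Definition vclass v : qvert theta := Sub (vorbit theta v) (vorbit_in v).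

Lemma mem_vclass v : v \in val (vclass v).
Proof. by rewrite /= -[X in X \in _]theta1; apply: imset_f. Qed.

Lemma mem_vorbit v w : w \in vorbit theta v -> exists g, w = theta g v.
Proof. by case/imsetP=> g _ ->; exists g. Qed.

Lemma vorbit_theta g v : vorbit theta (theta g v) = vorbit theta v.
Proof.
apply/setP => w; apply/imsetP/imsetP => -[h _ ->]; exists (h * g)%g; rewrite ?inE //.
  by rewrite thetaM.
by rewrite thetaM -mulgA Z2_mulVV mulg1.
Qed.

Lemma vclass_theta g v : vclass (theta g v) = vclass v.
Proof. by apply: val_inj; apply: vorbit_theta. Qed.

Lemma vclass_mem a v : v \in val a -> vclass v = a.
Proof.
case: a => A AP; have /imsetP[w _ AE] := AP => /= vA; apply: val_inj => /=.
by move: vA; rewrite AE => /mem_vorbit[g ->]; apply: vorbit_theta.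
Qed.

Lemma eorbit_in e : e \in E -> eorbit theta e \in [set eorbit theta e | e in E].
Proof. by move=> eE; apply: imset_f. Qed.

Definition eclass e (eE : e \in E) : qedge E theta := Sub (eorbit theta e) (eorbit_in eE).

Lemma mem_eclass e (eE : e \in E) : e \in val (eclass eE).
Proof.
by rewrite /= -[X in X \in _]theta_set1; apply: (imset_f (fun g => theta g @: e)).
Qed.

Lemma qedgeP o e : e \in val o -> e \in E /\ val o = eorbit theta e.
Proof.
case: o => A AP; have /imsetP[f fE AE] := AP => /=; rewrite AE.
case/imsetP=> g _ ->; split; first exact: theta_edge.
apply/setP => e'; apply/imsetP/imsetP => -[h _ ->]; exists (h * g)%g; rewrite ?inE //.
  by rewrite theta_setM -mulgA Z2_mulVV mulg1.
by rewrite theta_setM.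
Qed.

Lemma qedge_inj o o' e : e \in val o -> e \in val o' -> o = o'.
Proof. by move=> /qedgeP[_ oE] /qedgeP[_ oE']; apply: val_inj; rewrite oE. Qed.

Lemma qedge_edge o e : e \in val o -> e \in E.
Proof. by case/qedgeP. Qed.

Lemma qedge_theta o e g : e \in val o -> theta g @: e \in val o.
Proof.
by case/qedgeP=> _ ->; apply: (imset_f (fun g => theta g @: e)).
Qed.

Lemma qedge_orbit o e e' : e \in val o -> e' \in val o -> exists g, e' = theta g @: e.
Proof. by case/qedgeP=> _ -> /imsetP[g _ ->]; exists g. Qed.

Lemma qedge_nonempty o : exists v w, [set v; w] \in val o.
Proof.
have /imsetP[e eE oE] := valP o.
have e_o : e \in val o.
  by rewrite oE -[X in X \in _]theta_set1; apply: (imset_f (fun g => theta g @: e)).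
case: sym => /(_ e eE)/eqP/cards2P[v [w [_ evw]]] _ _.
by exists v, w; rewrite -evw.
Qed.

Variables (rep : qvert theta -> V).
Hypothesis rep_orbit : representatives rep.
Let H := quotient_gain_graph E rep.

Lemma vclass_rep a : vclass (rep a) = a.
Proof. exact: vclass_mem. Qed.

Lemma rep_vclass v : exists g, v = theta g (rep (vclass v)).
Proof.
have /mem_vorbit[g ->] := rep_orbit (vclass v).
by exists g; rewrite thetaK.
Qed.

Lemma qjoinsP o a b : reflect (exists v w, [/\ vclass v = a, vclass w = b
  & [set v; w] \in val o]) (qjoins o a b).
Proof.
apply: (iffP idP) => [/existsP[v /andP[va /existsP[w /andP[wb vw]]]]|].
  by exists v, w; rewrite !(vclass_mem va, vclass_mem wb).
case=> v [w [<- <- vw]]; apply/existsP; exists v; rewrite mem_vclass.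
by apply/existsP; exists w; rewrite mem_vclass.
Qed.

Lemma quotient_proper_joins : proper_joins H.
Proof.
split=> [o a b | o a b a' b' /qjoinsP[v [w [<- <- vw]]] /qjoinsP[v' [w' [<- <- vw']]]].
  by apply/qjoinsP/qjoinsP => -[v [w [<- <- vw]]]; exists w, v; rewrite finset.setUC.
have [g] := qedge_orbit vw vw'; rewrite theta_set2 => /set2_eq.
by case=> -[-> ->]; rewrite !vclass_theta; [left | right].
Qed.

Lemma quotient_ends (o : gedge H) : exists a b, @joins H o a b.
Proof.
have [v [w vw]] := qedge_nonempty o; exists (vclass v), (vclass w).
by apply/qjoinsP; exists v, w.
Qed.

(** An edge of the orbit can be moved to start at [rep a], so the [pick] in [qgain] succeeds. If it
    found the ends in the opposite order, acting by the gain, which is its own inverse, exchanges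
    them. *)
Lemma qgainP o a b : qjoins o a b ->
  [set rep a; theta (qgain rep o) (rep b)] \in val o.
Proof.
move=> jab; have /qjoinsP[v [w [va wb vw]]] := jab.
have [g vg] := rep_vclass v; have [h wh] := rep_vclass w; rewrite va in vg; rewrite wb in wh.
rewrite /qgain; case: pickP => [k /existsP[a' /existsP[b' /andP[jab' kab]]] | noP] /=.
  have [[-> ->] | [-> ->]] := joins_ends quotient_proper_joins (e := o) jab jab'.
    by [].
  by have := qedge_theta k kab; rewrite theta_set2 thetaK finset.setUC.
have := noP (g * h)%g; case/existsP; exists a; apply/existsP; exists b.
rewrite jab; have := qedge_theta g vw; rewrite theta_set2 {1}vg thetaK wh thetaM.
by [].
Qed.

(** * Equivariant functions as functions on the quotient *)

Section SymmetricFunctions.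
Variables (K : fieldType) (s : K).
Hypothesis s_sqr : s * s = 1.

Definition character (g : 'Z_2) : K := if g == neg1 then s else 1.

Lemma characterM g h : character (g * h)%g = character g * character h.
Proof.
rewrite /character.
by case: (Z2P g) (Z2P h) => -> [] -> /=; rewrite ?mulr1 ?mul1r ?s_sqr.
Qed.

Lemma character_sqr g : character g * character g = 1.
Proof. by rewrite -characterM Z2_mulVV. Qed.

Lemma character_neq0 g : character g != 0.
Proof.
apply/eqP => g0; have := character_sqr g; rewrite g0 mul0r => /eqP.
by rewrite eq_sym oner_eq0.
Qed.

Definition equivariant (f : V -> K) := forall g v, f (theta g v) = character g * f v.

Definition edge_constant (D : {set qedge E theta}) (f : V -> K) :=
  forall o v w, o \in D -> [set v; w] \in val o -> f v = f w.

Definition gain_sign (o : gedge H) : K := character (qgain rep o).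

Lemma gain_sign_sqr o : gain_sign o * gain_sign o = 1. Proof. exact: character_sqr. Qed.

(** A group element moves the edge to the one provided by [qgainP] and multiplies both values of [f]
    by the same nonzero scalar. When the ends come in the opposite order, both lie in one orbit. *)
Lemma equivariant_edge f o v w : equivariant f -> [set v; w] \in val o ->
  f v = f w <-> f (rep (vclass v)) = gain_sign o * f (rep (vclass w)).
Proof.
move=> ef vw; have jvw : qjoins o (vclass v) (vclass w) by apply/qjoinsP; exists v, w.
have [k] := qedge_orbit (qgainP jvw) vw; rewrite theta_set2 => /set2_eq.
have inj_k x y : character k * x = character k * y <-> x = y.
  by split=> [/(mulfI (character_neq0 k))|->].
case=> -[vE wE].
  have fv : f v = character k * f (rep (vclass v)) by rewrite {1}vE ef.
  have fw : f w = character k * (gain_sign o * f (rep (vclass w))) by rewrite {1}wE !ef.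
  by rewrite fv fw inj_k.
have fv : f v = character k * (gain_sign o * f (rep (vclass w))) by rewrite {1}vE !ef.
have fw : f w = character k * f (rep (vclass v)) by rewrite {1}wE ef.
rewrite fv fw inj_k; have -> : vclass v = vclass w by rewrite vE !vclass_theta vclass_rep.
by split=> /esym.
Qed.

(** The group component under the identification of [V] with pairs of a group element and an orbit,
    given by the representatives. *)
Definition level v : 'Z_2 := if v == rep (vclass v) then 1%g else neg1.

Lemma levelP v : v = theta (level v) (rep (vclass v)).
Proof.
rewrite /level; have [vE|nv] := eqVneq; first by rewrite -vE theta1.
have [g vg] := rep_vclass v; case: (Z2P g) vg => -> vg //.
by rewrite {1}vg theta1 eqxx in nv.
Qed.

Lemma level_theta g v : level (theta g v) = (g * level v)%g.
Proof.
rewrite /level vclass_theta; case: (Z2P g) => ->; first by rewrite theta1 mul1g.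
have := levelP v; rewrite /level; have [vE|nv] := eqVneq v _ => vE'.
  by rewrite -vE (negPf (theta_neq _)) mulg1.
by rewrite {1}vE' thetaK eqxx; apply: val_inj.
Qed.

(** The equivariant extension from the representatives, inverse to composition with [rep]. *)
Definition lift (F : qvert theta -> K) v := character (level v) * F (vclass v).

Lemma lift_equivariant F : equivariant (lift F).
Proof. by move=> g v; rewrite /lift level_theta vclass_theta characterM mulrA. Qed.

Lemma lift_rep F a : lift F (rep a) = F a.
Proof. by rewrite /lift /level vclass_rep eqxx /character /= mul1r. Qed.

Lemma equivariant_lift f : equivariant f -> f =1 lift (f \o rep).
Proof. by move=> ef v; rewrite {1}(levelP v) ef. Qed.

Lemma equivariant_potential f D : equivariant f ->
  edge_constant D f <-> potential (H := H) gain_sign D (f \o rep).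
Proof.
move=> ef; split=> [fD o a b oD /qjoinsP[v [w [<- <- vw]]] | pf o v w oD vw].
  by apply/(equivariant_edge ef vw)/(fD o).
by apply/(equivariant_edge ef vw)/pf => //; apply/qjoinsP; exists v, w.
Qed.

Lemma equivariant_kernel D :
  (forall F, potential (H := H) gain_sign D F -> forall a, F a = 0) <->
  (forall f, equivariant f -> edge_constant D f -> forall v, f v = 0).
Proof.
split=> [ker0 f ef fD v | ker0 F pF a].
  have /ker0 f0 := (equivariant_potential D ef).1 fD.
  rewrite (equivariant_lift ef) /lift; have /= -> := f0 (vclass v).
  by rewrite mulr0.
rewrite -(lift_rep F a); apply: ker0; first exact: lift_equivariant.
apply/equivariant_potential; first exact: lift_equivariant.
by move=> o b c oD jbc; rewrite /= !lift_rep; apply: pF.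
Qed.

Lemma equivariant_independent D :
  independent (H := H) gain_sign D <->
  (forall o, o \in D -> exists f, [/\ equivariant f, edge_constant (D :\ o) f
     & exists v w, [set v; w] \in val o /\ f v <> f w]).
Proof.
split=> indD o oD; have [] := indD o oD.
  move=> F [pF [a [b [/qjoinsP[v [w [va wb vw]]] Fab]]]]; exists (lift F).
  have eF := lift_equivariant F; split=> //.
    apply/equivariant_potential => // o' c d oD' jcd.
    by rewrite /= !lift_rep; apply: pF.
  exists v, w; split=> // /(equivariant_edge eF vw).
  by rewrite !lift_rep va wb.
move=> f [ef fD [v [w [vw fvw]]]]; exists (f \o rep); split.
  exact/equivariant_potential.
exists (vclass v), (vclass w); split; first by apply/qjoinsP; exists v, w.
by move/(equivariant_edge ef vw).
Qed.

End SymmetricFunctions.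

(** The map [vert] identifies the covering graph with the original one: it is injective because the
    action is free, and it sends edges over [o] into the orbit [o]. Simplicity is thus inherited. *)
Lemma quotient_simple_covering (D : {set gedge H}) : simple_covering D.
Proof.
pose vert (x : 'Z_2 * gvert H) : V := theta x.1 (rep x.2).
have vert_inj : injective vert.
  move=> [g a] [h b]; rewrite /vert /= => gh; have ab : a = b.
    by have := congr1 vclass gh; rewrite !vclass_theta !vclass_rep.
  rewrite ab in gh *; congr (_, _); case: (Z2P g) (Z2P h) gh => -> [] -> //.
    by rewrite theta1 => /eqP; rewrite eq_sym (negPf (theta_neq _)).
  by rewrite theta1 => /eqP; rewrite (negPf (theta_neq _)).
have cov (o : gedge H) f : f \in covering_edges o -> vert @: f \in val (o : qedge E theta).
  rewrite inE => /existsP[a /existsP[b /existsP[h /andP[jab /eqP->]]]].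
  rewrite imsetU1 imset_set1 /vert /=; have := qedge_theta h (qgainP jab).
  by rewrite theta_set2 thetaM.
split=> [o f oD /cov fo | o o' oD oD' neo].
  rewrite -(card_imset _ vert_inj); case: sym => simple _ _; apply: simple.
  exact: qedge_edge fo.
rewrite disjoint_subset; apply/fintype.subsetP => f /cov fo; rewrite inE.
by apply: contra neo => /cov fo'; apply/eqP; apply: qedge_inj fo fo'.
Qed.

(** * Graph conditions in terms of functions on the framework's vertices *)

Section Characterizations.
Variable K : fieldType.
Hypothesis two_neq0 : 2 != 0 :> K.

Let N1_sqr : (-1) * (-1) = 1 :> K. Proof. by rewrite mulrNN mulr1. Qed.
Let one_sqr : 1 * 1 = 1 :> K. Proof. exact: mulr1. Qed.

Lemma N1_neq1 : (-1 : K) <> 1.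
Proof.
move=> /eqP; rewrite -subr_eq0 -opprD oppr_eq0; exact/negP.
Qed.

(** The sign character turns products of gains into products of scalars, and it is faithful because
    -1 differs from 1 in [K]. *)
Lemma unbalancedP (C : {set gedge H}) :
  unbalanced C <-> \prod_(e in C) gain_sign (-1 : K) e <> 1.
Proof.
have -> : \prod_(e in C) gain_sign (-1 : K) e = character (-1) (\prod_(e in C) @gain H e)%g.
  rewrite (big_morph (character (-1 : K)) (characterM N1_sqr) (erefl : character (-1 : K) 1%g = 1)).
  by [].
rewrite /unbalanced /character; case: eqVneq => [->|ne]; first by split=> // _; exact: N1_neq1.
by split=> // /eqP; rewrite (negPf ne).
Qed.

Lemma unbalanced_map_graphP (D : {set gedge H}) : unbalanced_map_graph D <->
  map_graph D /\ forall C, cycle_of D C -> \prod_(e in C) gain_sign (-1 : K) e <> 1.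
Proof.
split=> [[mapD _ unbD]|[mapD unbD]].
  by split=> // C /unbD/unbalancedP.
split=> //; first exact: quotient_simple_covering.
by move=> C /unbD/unbalancedP.
Qed.

Lemma unbalanced_map_graph_equivariant D :
  @unbalanced_map_graph H D <->
  (forall f, equivariant (-1 : K) f -> edge_constant D f -> forall v, f v = 0) /\
  (forall o, o \in D -> exists f, [/\ equivariant (-1 : K) f, edge_constant (D :\ o) f
     & exists v w, [set v; w] \in val o /\ f v <> f w]).
Proof.
rewrite unbalanced_map_graphP -equivariant_kernel // -equivariant_independent //.
split=> [[mapD unbD] | [ker0 indD]].
  apply: map_graph_potential_basis => //.
  - exact: quotient_proper_joins.
  - exact: gain_sign_sqr.
  - exact: quotient_ends.
exact: (potential_basis_map_graph quotient_proper_joins (gain_sign_sqr N1_sqr) ker0 indD).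
Qed.

Lemma gain_sign1 : gain_sign (1 : K) = fun=> 1.
Proof. by apply/funext => o; rewrite /gain_sign /character if_same. Qed.

Lemma equivariant1_const D :
  (forall F, potential (H := H) (fun=> 1 : K) D F -> forall a b, F a = F b) <->
  (forall f, equivariant (1 : K) f -> edge_constant D f -> forall v w, f v = f w).
Proof.
have lift1 (F : qvert theta -> K) v : lift 1 F v = F (vclass v).
  by rewrite /lift /character if_same mul1r.
split=> [cD f ef fD v w | cD F pF a b].
  rewrite !(equivariant_lift ef) !lift1; apply: (cD (f \o rep)).
  by rewrite -gain_sign1; apply/(equivariant_potential one_sqr).
rewrite -(lift_rep 1 F a) -(lift_rep 1 F b); have eF := lift_equivariant one_sqr F.
apply: cD => //; apply/(equivariant_potential one_sqr D eF).
by rewrite gain_sign1 => o x y oD jxy; rewrite /= !lift_rep; apply: (pF o).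
Qed.

Lemma is_tree_equivariant D :
  @is_tree H D <->
  (forall f, equivariant (1 : K) f -> edge_constant D f -> forall v w, f v = f w) /\
  (forall o, o \in D -> exists f, [/\ equivariant (1 : K) f, edge_constant (D :\ o) f
     & exists v w, [set v; w] \in val o /\ f v <> f w]).
Proof.
rewrite (is_treeP K quotient_proper_joins D quotient_ends).
by rewrite -equivariant1_const -equivariant_independent // gain_sign1.
Qed.

(** The sum and the difference of [f] and its translate by [neg1] are again constant along edges;
    the first is even, hence constant, and the second is odd, hence zero. Conversely, an odd
    constant function is zero because 2 is invertible. *)
Lemma connected_map_graph_equivariant (D : {set gedge H}) :
  (exists D' : {set gedge H}, [/\ D' \subset D, connected_graph D'
     & unbalanced_map_graph D']) <->
  (forall f : V -> K, edge_constant D f -> forall v w, f v = f w).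
Proof.
have -> : (exists D' : {set gedge H}, [/\ D' \subset D, connected_graph D'
     & unbalanced_map_graph D']) <->
  (exists D' : {set gedge H}, [/\ D' \subset D, connected_graph D', map_graph D' &
    forall C, cycle_of D' C -> \prod_(e in C) gain_sign (-1 : K) e <> 1]).
  split=> -[D' [? ?]] => [/unbalanced_map_graphP[]|??]; exists D'; split=> //.
  exact/unbalanced_map_graphP.
rewrite -(connected_map_graph_exists quotient_proper_joins (gain_sign_sqr N1_sqr)).
rewrite equivariant1_const equivariant_kernel //.
split=> [[cD zD] f fD v w | cD]; last first.
  split=> [f _ /cD //|f ef /cD cf v].
  have := ef neg1 v; rewrite (cf _ v) /character eqxx mulN1r => /eqP.
  by rewrite -addr_eq0 -mulr2n -mulr_natl mulf_eq0 (negPf two_neq0) => /eqP.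
have fD' g : edge_constant D (fun u => f (theta g u)).
  by move=> o x y oD xy; apply: (fD o) => //; rewrite -theta_set2; apply: qedge_theta.
have e1 : forall v w, f v + f (theta neg1 v) = f w + f (theta neg1 w).
  apply: (cD (fun u => f u + f (theta neg1 u))).
    move=> g u; rewrite /character if_same mul1r; case: (Z2P g) => ->.
      by rewrite theta1.
    by rewrite thetaK addrC.
  by move=> o x y oD xy; congr (_ + _); [apply: fD xy | apply: (fD' neg1) xy].
have e2 : forall v, f v - f (theta neg1 v) = 0.
  apply: (zD (fun u => f u - f (theta neg1 u))).
    move=> g u; rewrite /character; case: (Z2P g) => ->; first by rewrite theta1 mul1r.
    by rewrite thetaK eqxx mulN1r opprB.
  by move=> o x y oD xy; congr (_ - _); [apply: fD xy | apply: (fD' neg1) xy].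
apply: (mulfI two_neq0); rewrite !mulr_natl !mulr2n.
by have := e1 v w; rewrite -!(subr0_eq (e2 _)).
Qed.

End Characterizations.

End Quotient.

(** * Decoupling the two colours *)

Section Coordinates.
Variables (K : fieldType) (V : finType) (N : 'M[K]_2).
Hypothesis uN : N \in unitmx.
Implicit Types (z : 'M[K]_(#|V|, 2)) (f : V -> K).

Definition coord z k v : K := (at_vertex z v *m N) 0 k.

(** The configuration with [f] as coordinate [k] and zero as the other coordinate. *)
Definition along k f : 'M[K]_(#|V|, 2) :=
  configuration (fun v => f v *: row k (invmx N)).

Lemma coord_along k f j v : coord (along k f) j v = if j == k then f v else 0.
Proof.
rewrite /coord at_configuration -scalemxAl -row_mul mulVmx // !mxE eq_sym.
by case: eqP; rewrite ?mulr1 ?mulr0.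
Qed.

Lemma coord_sum (I : finType) (c : I -> K) (z : I -> 'M[K]_(#|V|, 2)) k v :
  coord (\sum_i c i *: z i) k v = \sum_i c i * coord (z i) k v.
Proof.
rewrite /coord /at_vertex linear_sum mulmx_suml summxE; apply: eq_bigr => i _.
by rewrite linearZ -scalemxAl mxE.
Qed.

Lemma at_vertex_coord_inj z z' v w :
  (forall k, coord z k v = coord z' k w) -> at_vertex z v = at_vertex z' w.
Proof.
by move=> zz'; apply: (can_inj (mulmxK uN)); apply/rowP => k; apply: zz'.
Qed.

End Coordinates.

(** * Kernel and image of the rigidity matrix, one colour at a time *)

Section SymmetricFramework.
Variables (R : realType) (nrm : 'rV[R]_2 -> R) (M : 'M[R]_2).
Hypothesis nrm_norm : is_norm nrm.
Hypothesis uM : M \in unitmx.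
Hypothesis nrmE : forall x, nrm x = Num.max `|(x *m M) 0 0| `|(x *m M) 0 1|.
Variables (V : finType) (E : {set {set V}}) (p : 'M[R]_(#|V|, 2)).
Variable theta : {morphism [set: 'Z_2]%SET >-> {perm V}}.
Variable tau : mx_representation R [set: 'Z_2]%SET 2.
Hypothesis G_symmetric : C2_symmetric_framework nrm E p theta tau.
Hypothesis wpos : well_positioned nrm E p.
Implicit Types (o : qedge E theta) (v w : V) (k : 'I_2).

Let bar_joint : bar_joint_framework E p. Proof. by case: G_symmetric. Qed.
Let sym : Z2_symmetric_graph E theta. Proof. by case: G_symmetric. Qed.

Definition facet k : set 'rV[R]_2 := [set x | nrm x <= 1 /\ (x *m M) 0 k = 1]%classic.

Definition mono k : {set qedge E theta} := monochrome nrm E p theta (facet k).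

Lemma tauN1 : tau neg1 = - 1%:M.
Proof. by case: G_symmetric. Qed.

Lemma edge_vec_theta v w : edge_vec p (theta neg1 v) (theta neg1 w) = - edge_vec p v w.
Proof.
case: G_symmetric => _ _ _ pth _.
by rewrite /edge_vec -!pth tauN1 !mulmxN !mulmx1 opprD.
Qed.

Lemma coloured_theta g k v w :
  coloured nrm M p k (theta g v) (theta g w) = coloured nrm M p k v w.
Proof.
case: (Z2P g) => ->; first by rewrite !theta1.
by rewrite /coloured edge_vec_theta (nrmN nrm_norm) mulNmx mxE normrN.
Qed.

(** Any edge of the orbit can be tested, since the half-turn only negates the edge vector. *)
Lemma monoP k o v w : [set v; w]%SET \in val o ->
  (o \in mono k) = coloured nrm M p k v w.
Proof.
move=> vw; have vwE := qedge_edge sym vw.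
rewrite inE; apply/asboolP/idP => [[e eo [a [b [eab colab]]]] | vwc]; last first.
  exists [set v; w]%SET => //.
  by apply/(framework_colourP nrm_norm bar_joint (F := facet k) (k := k) (erefl _) vwE).
have abE : [set a; b]%SET \in E by rewrite -eab; apply: qedge_edge eo.
have abc : coloured nrm M p k a b.
  apply/(framework_colourP nrm_norm bar_joint (F := facet k) (k := k) (erefl _) abE).
  by exists a, b.
rewrite eab in eo; have [g] := qedge_orbit sym eo vw; rewrite theta_set2 => /set2_eq.
by case=> -[-> ->]; rewrite coloured_theta ?(colouredC M nrm_norm p k b a).
Qed.

Lemma mono_cases o : exists k, o \in mono k.
Proof.
have [v [w vw]] := qedge_nonempty sym o; have vwE := qedge_edge sym vw.
have [c0|] := boolP (coloured nrm M p 0 v w); first by exists 0; rewrite (monoP 0 vw).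
rewrite -(coloured_other nrm_norm uM nrmE bar_joint wpos) // => c1.
by exists (other_coord 0); rewrite (monoP _ vw).
Qed.

Lemma mono_disjoint : [disjoint mono 0 & mono 1].
Proof.
apply/pred0P => o; apply/negbTE/negP => /andP[/= o0].
have [v [w vw]] := qedge_nonempty sym o; have vwE := qedge_edge sym vw.
rewrite -[1]/(other_coord 0) (monoP _ vw) (coloured_other nrm_norm uM nrmE bar_joint wpos) //.
by rewrite -(monoP 0 vw) o0.
Qed.

Lemma edge_mono (i : 'I_#|E|) : exists o k v w, [/\ o \in mono k, [set v; w]%SET \in val o,
  coloured nrm M p k v w & enum_val i = [set v; w]%SET :> {set V}].
Proof.
have iE := enum_valP i; have io := mem_eclass theta iE; set o := eclass theta iE in io.
have /cards2P[v [w [_ ivw]]] : #|enum_val i| == 2 by apply/eqP/(proj1 bar_joint).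
have [k ok] := mono_cases o; exists o, k, v, w; rewrite -ivw; split=> //.
by rewrite -(monoP k (o := o)) // -ivw.
Qed.

(* The rigidity map's differential and its complexification both have the shape of D:
   at an edge of colour k, plus or minus the difference of the k-th coordinates. *)
Section Differential.
Variables (K : fieldType) (N : 'M[K]_2) (sg : 'I_2 -> V -> V -> K).
Variable D : 'M[K]_(#|V|, 2) -> 'rV[K]_#|E|.
Implicit Types (f : V -> K) (z : 'M[K]_(#|V|, 2)) (y : 'rV[K]_#|E|).
Hypothesis uN : N \in unitmx.
Hypothesis sg_neq0 : forall k v w,
  [set v; w]%SET \in E -> coloured nrm M p k v w -> sg k v w != 0.
Hypothesis sg_theta : forall k v w, sg k (theta neg1 v) (theta neg1 w) = - sg k v w.
Hypothesis DE : forall k v w (i : 'I_#|E|) z, enum_val i = [set v; w]%SET ->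
  coloured nrm M p k v w -> D z 0 i = sg k v w * (coord N z k v - coord N z k w).

Lemma D_eq0 z : D z = 0 <-> forall k, edge_constant (mono k) (coord N z k).
Proof.
split=> [Dz k o v w ok vw | zc].
  have vwE := qedge_edge sym vw; have col : coloured nrm M p k v w by rewrite -(monoP k vw).
  have := DE z (enum_rankK_in vwE vwE) col; rewrite Dz mxE => /esym/eqP.
  by rewrite mulf_eq0 (negPf (sg_neq0 vwE col)) subr_eq0 => /eqP.
apply/rowP => i; rewrite [RHS]mxE; have [o [k [v [w [ok vw col ivw]]]]] := edge_mono i.
by rewrite (DE z ivw col) (zc k o v w ok vw) subrr mulr0.
Qed.

Lemma D_const z : (forall v w, at_vertex z v = at_vertex z w) -> D z = 0.
Proof. by move=> zc; apply/D_eq0 => k o v w _ _; rewrite /coord (zc v w). Qed.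

(** A function for one colour is tested by [along], whose other coordinate vanishes and so meets the
    equations of the other colour. *)
Lemma kernel_constP :
  (forall z, D z = 0 -> forall v w, at_vertex z v = at_vertex z w) <->
  (forall k f, edge_constant (mono k) f -> forall v w, f v = f w).
Proof.
split=> [zc k f fc v w | fc z /D_eq0 zc v w]; last first.
  by apply: (at_vertex_coord_inj uN) => k; apply: fc (zc k) v w.
have Dz : D (along N k f) = 0.
  apply/D_eq0 => j o a b oj ab; rewrite !coord_along //; case: eqP => // jk.
  by apply: (fc o) => //; rewrite -jk.
have := zc _ Dz v w; move/(congr1 (fun x => (x *m N) 0 k)).
by rewrite -/(coord N _ k v) -/(coord N _ k w) !coord_along ?eqxx.
Qed.

Section Character.
Variable s : K.
Hypothesis s_sqr : s * s = 1.

Definition Xsym z := forall k, equivariant theta s (coord N z k).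

(** The factor is [- s] because the sign [sg] of an edge changes under the half-turn while the
    coordinates of the configuration are multiplied by [s]. *)
Definition Ysym (y : 'rV[K]_#|E|) := forall i j : 'I_#|E|,
  enum_val j = (theta neg1 @: (enum_val i : {set V}))%SET -> y 0 j = - s * y 0 i.

Lemma Xsym_along k f : equivariant theta s f -> Xsym (along N k f).
Proof.
move=> ef j g v; rewrite !coord_along //; case: eqP => _; first exact: ef.
by rewrite mulr0.
Qed.

Lemma Xsym_Ysym z : Xsym z -> Ysym (D z).
Proof.
move=> zX i j ij; have [o [k [v [w [ok vw col ivw]]]]] := edge_mono i.
rewrite (DE z ivw col); rewrite ivw theta_set2 in ij.
rewrite (DE (k := k) z ij) ?coloured_theta //.
by rewrite sg_theta !zX /character eqxx; ring.
Qed.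

Lemma kernel0P :
  (forall z, Xsym z -> D z = 0 -> z = 0) <->
  (forall k f, equivariant theta s f -> edge_constant (mono k) f -> forall v, f v = 0).
Proof.
split=> [ker0 k f ef fc v | ker0 z zX /D_eq0 zc]; last first.
  apply: at_vertex_inj => v; rewrite at_vertex0; apply: (can_inj (mulmxK uN)).
  by rewrite mul0mx; apply/rowP => k; rewrite [RHS]mxE; apply: ker0 (zX k) (zc k) v.
have Dz : D (along N k f) = 0.
  apply/D_eq0 => j o a b oj ab; rewrite !coord_along //; case: eqP => // jk.
  by apply: (fc o) => //; rewrite -jk.
have -> : f v = coord N (along N k f) k v by rewrite coord_along ?eqxx.
by rewrite (ker0 _ (Xsym_along k ef) Dz) /coord at_vertex0 mul0mx mxE.
Qed.

Lemma kernel_equivariant_constP :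
  (forall z, Xsym z -> D z = 0 -> forall v w, at_vertex z v = at_vertex z w) <->
  (forall k f, equivariant theta s f -> edge_constant (mono k) f ->
     forall v w, f v = f w).
Proof.
split=> [zc k f ef fc v w | fc z zX /D_eq0 zc v w]; last first.
  by apply: (at_vertex_coord_inj uN) => k; apply: fc (zX k) (zc k) v w.
have Dz : D (along N k f) = 0.
  apply/D_eq0 => j o a b oj ab; rewrite !coord_along //; case: eqP => // jk.
  by apply: (fc o) => //; rewrite -jk.
have := zc _ (Xsym_along k ef) Dz v w; move/(congr1 (fun x => (x *m N) 0 k)).
by rewrite -/(coord N _ k v) -/(coord N _ k w) !coord_along ?eqxx.
Qed.

(** Each coordinate of a preimage of a vector supported on a single edge orbit is constant along all
    other edges of its colour. *)
Lemma surjective_independent :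
    s = -1 \/ no_fixed_edge E theta ->
    (forall y, Ysym y -> exists2 z, Xsym z & D z = y) ->
  forall k o, o \in mono k -> exists f, [/\ equivariant theta s f,
    edge_constant (mono k :\ o)%SET f & exists v w, [set v; w]%SET \in val o /\ f v <> f w].
Proof.
move=> fixed surj k o ok; have [v [w vw]] := qedge_nonempty sym o.
have vwE := qedge_edge sym vw; set e := [set v; w]%SET in vw vwE.
pose te := (theta neg1 @: e)%SET.
have teK : (theta neg1 @: te)%SET = e by rewrite theta_setM Z2_mulVV theta_set1.
(* The symmetric vector supported on the orbit of [e]. If [e] is its own image, symmetry forces
   [- s = 1]; hence the alternative in the hypotheses. *)
pose y : 'rV[K]_#|E| := \row_i (if enum_val i == e then 1 else
  if enum_val i == te then - s else 0).
have [|z zX Dz] := surj y.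
  move=> i j ij; rewrite !mxE ij.
  have ti : (theta neg1 @: enum_val i)%SET == e = (enum_val i == te).
    by apply/eqP/eqP => [h|->//]; rewrite /te -h theta_setM Z2_mulVV theta_set1.
  have ti' : (theta neg1 @: enum_val i)%SET == te = (enum_val i == e).
    by apply/eqP/eqP => [h|->//]; rewrite -teK -h theta_setM Z2_mulVV theta_set1.
  rewrite ti ti'; have [ie|nie] := eqVneq (enum_val i) e; last first.
    by case: eqP; rewrite ?mulr0 // mulrNN s_sqr.
  have [ite|_] := eqVneq (enum_val i) te; last by rewrite mulr1.
  case: fixed => [->|/(_ e vwE)]; first by rewrite opprK mulr1.
  by rewrite -/te -ite ie eqxx.
have col : coloured nrm M p k v w by rewrite -(monoP k vw).
exists (coord N z k); split=> //; last first.
  exists v, w; split=> // zvw; have := DE z (enum_rankK_in vwE vwE) col.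
  rewrite Dz mxE (enum_rankK_in vwE vwE) eqxx zvw subrr mulr0 => /eqP.
  by rewrite oner_eq0.
move=> o' a b; rewrite in_setD1 => /andP[neo ok'] ab.
have abE := qedge_edge sym ab; have colab : coloured nrm M p k a b by rewrite -(monoP k ab).
have := DE z (enum_rankK_in abE abE) colab; rewrite Dz mxE (enum_rankK_in abE abE).
have nab (f : {set V}) : f \in val o -> ([set a; b]%SET == f) = false.
  move=> fo; apply/eqP => abf; case/eqP: neo; rewrite abf in ab.
  exact: (qedge_inj sym ab fo).
rewrite !nab // ?(qedge_theta sym) // => /esym/eqP.
by rewrite mulf_eq0 (negPf (sg_neq0 abE colab)) subr_eq0 => /eqP.
Qed.

(** For each edge orbit there is a symmetric configuration whose image is supported on that orbit. A
    combination of these matches [y] at one edge of every orbit, and symmetry gives the other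
    edge. *)
Lemma independent_surjective :
    (forall k o, o \in mono k -> exists f, [/\ equivariant theta s f,
      edge_constant (mono k :\ o)%SET f & exists v w, [set v; w]%SET \in val o /\ f v <> f w]) ->
  forall y, Ysym y -> exists2 z, Xsym z & D z = y.
Proof.
move=> indep y yY.
have ex (o : qedge E theta) : exists zi : 'M[K]_(#|V|, 2) * 'I_#|E|,
   [/\ Xsym zi.1, enum_val zi.2 \in val o, D zi.1 0 zi.2 != 0 &
     forall j, enum_val j \notin val o -> D zi.1 0 j = 0].
  have [k ok] := mono_cases o.
  have [f [ef fc [v [w [vw fvw]]]]] := indep k o ok; have vwE := qedge_edge sym vw.
  have col : coloured nrm M p k v w by rewrite -(monoP k vw).
  exists (along N k f, enum_rank_in vwE [set v; w]%SET); split=> /=.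
  - exact: Xsym_along.
  - by rewrite enum_rankK_in.
  - rewrite (DE _ (enum_rankK_in vwE vwE) col) !coord_along // eqxx.
    by rewrite mulf_neq0 ?(sg_neq0 vwE col) // subr_eq0; apply/eqP.
  move=> j jo; have [o' [k' [a [b [ok' ab cab jab]]]]] := edge_mono j.
  rewrite (DE _ jab cab) !coord_along //; case: eqP => [kk'|]; last by rewrite subrr mulr0.
  rewrite (fc o' a b) ?subrr ?mulr0 // in_setD1 -kk' ok' andbT.
  by apply: contraNneq jo => <-; rewrite jab.
have [zi ziP] := choice ex.
pose c o := y 0 (zi o).2 / D (zi o).1 0 (zi o).2.
exists (\sum_o c o *: (zi o).1).
  move=> k g v; rewrite !coord_sum mulr_sumr; apply: eq_bigr => o _.
  by have [zX _ _ _] := ziP o; rewrite zX mulrCA.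
apply/rowP => i; have [o [k [v [w [ok vw col ivw]]]]] := edge_mono i.
have -> : D (\sum_o c o *: (zi o).1) 0 i = \sum_o c o * D (zi o).1 0 i.
  rewrite (DE _ ivw col) !coord_sum -sumrB mulr_sumr; apply: eq_bigr => o' _.
  by rewrite (DE _ ivw col); ring.
rewrite (bigD1 o) //= big1 ?addr0; last first.
  move=> o' neo; have [_ _ _ -> ] := ziP o'; rewrite ?mulr0 //.
  rewrite ivw; apply: contraNN neo => vw'; apply/eqP.
  exact: (qedge_inj sym vw' vw).
have [zX io Dn0 _] := ziP o; rewrite -ivw in vw.
have [g] := qedge_orbit sym io vw; case: (Z2P g) => ->.
  by rewrite theta_set1 => /enum_val_inj->; rewrite /c divfK.
move=> ig; rewrite (yY _ _ ig) (Xsym_Ysym zX ig) /c mulrCA divfK //.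
Qed.

End Character.
End Differential.

End SymmetricFramework.

(** * Isostaticity and rigidity *)

Section Complexification.
Variable R : realType.

Lemma complexify_Re_Im m n (z : 'M[R[i]]_(m, n)) :
  z = complexify (map_mx (@complex.Re R) z) +
      (0 +i* 1)%C *: complexify (map_mx (@complex.Im R) z).
Proof.
apply/matrixP => i j; rewrite !mxE; case: (z i j) => a b /=.
by apply/eqP; rewrite eq_complex /=; apply/andP; split; apply/eqP; ring.
Qed.

Lemma complex_motion_fieldsP (nrm : 'rV[R]_2 -> R) (M : 'M[R]_2) zeta :
    M \in unitmx ->
    (forall x, nrm x = Num.max `|(x *m M) 0 0| `|(x *m M) 0 1|) ->
  complex_motion_fields nrm zeta <-> exists c, zeta = fun=> c.
Proof.
move=> uM nrmE; split=> [[n [c [eta [etaP zetaE]]]] | [c ->]].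
  exists (zeta 0); apply/funext => x; rewrite !zetaE; apply: eq_bigr => i _.
  by have [d ->] := (motion_fieldsP uM nrmE (eta i)).1 (etaP i).
exists 2, (fun i => c 0 i), (fun i _ => delta_mx 0 i); split=> [i|_].
  by apply/(motion_fieldsP uM nrmE); exists (delta_mx 0 i).
rewrite [LHS]row_sum_delta; apply: eq_bigr => i _; congr (_ *: _).
by rewrite /complexify map_delta_mx.
Qed.

End Complexification.

(** * Rigidity and isostaticity as conditions on functions *)

Section Isostaticity.
Variables (R : realType) (nrm : 'rV[R]_2 -> R) (M : 'M[R]_2).
Hypothesis nrm_norm : is_norm nrm.
Hypothesis uM : M \in unitmx.
Hypothesis nrmE : forall x, nrm x = Num.max `|(x *m M) 0 0| `|(x *m M) 0 1|.
Variables (V : finType) (E : {set {set V}}) (p : 'M[R]_(#|V|, 2)).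
Variable theta : {morphism [set: 'Z_2]%SET >-> {perm V}}.
Variable tau : mx_representation R [set: 'Z_2]%SET 2.
Hypothesis G_symmetric : C2_symmetric_framework nrm E p theta tau.
Hypothesis wpos : well_positioned nrm E p.

Let bar_joint : bar_joint_framework E p. Proof. by case: G_symmetric. Qed.
Let sym : Z2_symmetric_graph E theta. Proof. by case: G_symmetric. Qed.

Notation N := (complexify M).
Notation mono := (mono nrm M E p theta).
Notation dR := ('d (rigidity_map nrm E) p).
Notation dC := (complex_differential nrm E p).

Definition edge_sign (k : 'I_2) v w : R := Num.sg ((edge_vec p v w *m M) 0 k).

Lemma edge_sign_neq0 k v w : [set v; w]%SET \in E -> coloured nrm M p k v w ->
  edge_sign k v w != 0.
Proof.
move=> vwE /eqP col; rewrite sgr_eq0 -normr_eq0 -col gt_eqF //.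
exact/(nrm_gt0 nrm_norm)/(edge_vec_neq0 bar_joint).
Qed.

Lemma edge_sign_theta k v w :
  edge_sign k (theta neg1 v) (theta neg1 w) = - edge_sign k v w.
Proof.
by rewrite /edge_sign (edge_vec_theta G_symmetric) mulNmx mxE sgrN.
Qed.

Lemma real_differentialE (k : 'I_2) v w (i : 'I_#|E|) z : enum_val i = [set v; w]%SET ->
  coloured nrm M p k v w ->
  dR z 0 i = edge_sign k v w * (coord M z k v - coord M z k w).
Proof.
move=> ei col; rewrite (differentialE nrm_norm uM nrmE bar_joint wpos z ei col).
by congr (_ * _); rewrite mulmxBl mxE [X in _ + X]mxE.
Qed.

Definition edge_signC (k : 'I_2) v w : R[i] := real_complex R (edge_sign k v w).

Lemma edge_signC_neq0 k v w : [set v; w]%SET \in E -> coloured nrm M p k v w ->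
  edge_signC k v w != 0.
Proof. by move=> vwE /(edge_sign_neq0 vwE); rewrite fmorph_eq0. Qed.

Lemma edge_signC_theta k v w :
  edge_signC k (theta neg1 v) (theta neg1 w) = - edge_signC k v w.
Proof. by rewrite /edge_signC edge_sign_theta rmorphN. Qed.

Lemma complex_differentialE (k : 'I_2) v w (i : 'I_#|E|) z :
  enum_val i = [set v; w]%SET -> coloured nrm M p k v w ->
  dC z 0 i = edge_signC k v w * (coord N z k v - coord N z k w).
Proof.
move=> ei col; rewrite /complex_differential /complex_extension !mxE.
rewrite !(real_differentialE _ ei col) !rmorphM !rmorphB -/(edge_signC k v w) /=.
have coordE u : coord N z k u =
    real_complex R (coord M (map_mx (@complex.Re R) z) k u) +
    (0 +i* 1)%C * real_complex R (coord M (map_mx (@complex.Im R) z) k u).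
  rewrite /coord {1}(complexify_Re_Im z) at_vertexD at_vertexZ mulmxDl -scalemxAl.
  rewrite mxE [X in _ + X]mxE; congr (_ + _ * _).
    by rewrite /at_vertex -map_row -map_mxM mxE.
  by rewrite /at_vertex -map_row -map_mxM mxE.
rewrite !coordE; ring.
Qed.

Lemma unitN : N \in unitmx.
Proof. by rewrite map_unitmx. Qed.

(** Trivial motions are translations, so rigidity says that the kernel of the differential consists
    of constant configurations. *)
Lemma infinitesimally_rigidP : infinitesimally_rigid nrm E p <->
  forall k (f : V -> R), edge_constant (mono k) f -> forall v w, f v = f w.
Proof.
rewrite -(kernel_constP nrm_norm uM nrmE G_symmetric wpos uM edge_sign_neq0 real_differentialE).
have trivialP z : (exists2 eta, motion_fields nrm eta
     & forall v, at_vertex z v = eta (at_vertex p v)) <->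
     forall v w, at_vertex z v = at_vertex z w.
  split=> [[eta /(motion_fieldsP uM nrmE)[c ->] zv] v w | zc]; first by rewrite !zv.
  have [[v0 _] | noV] := EM (exists v : V, True); last first.
    exists (fun=> 0); first by apply/(motion_fieldsP uM nrmE); exists 0.
    by move=> v; case: noV; exists v.
  exists (fun=> at_vertex z v0); last by move=> v; apply: zc.
  by apply/(motion_fieldsP uM nrmE); exists (at_vertex z v0).
rewrite /infinitesimally_rigid; split=> [kerE z dz | kerE].
  by apply/trivialP; have : [set x | dR x = 0]%classic z by []; rewrite kerE.
apply/seteqP; split=> z /= hz; first by apply/trivialP/kerE.
apply: (D_const nrm_norm uM nrmE G_symmetric wpos edge_sign_neq0 real_differentialE).
exact/trivialP.
Qed.

Section Character.
Variables (chi : 'Z_2 -> R[i]) (s : R[i]).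
Hypothesis chi_1 : chi 1%g = 1.
Hypothesis chi_N1 : chi neg1 = - s.
Hypothesis s_sqr : s * s = 1.

Lemma complexify_tau g (c : 'rV[R[i]]_2) : c *m complexify (tau g) = character (-1) g *: c.
Proof.
case: (Z2P g) => ->; rewrite /character /=.
  by rewrite repr_mx1 /complexify map_mx1 mulmx1 scale1r.
by rewrite (tauN1 G_symmetric) /complexify map_mxN map_mx1 mulmxN mulmx1 scaleN1r.
Qed.

(** As [tau neg1] is minus the identity, the sign on coordinates is opposite to that of [chi]:
    [chi0] corresponds to [s = -1] and [chi1] to [s = 1]. *)
Lemma chi_character g : chi g * character (-1) g = character s g.
Proof.
case: (Z2P g) => ->; rewrite /character /= ?eqxx; first by rewrite chi_1 mulr1.
by rewrite chi_N1 mulrNN mulr1.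
Qed.

Lemma X_chiP z : X_chi theta tau chi z <-> Xsym theta N s z.
Proof.
split=> [zX k g v | zX g v].
  by rewrite /coord zX complexify_tau scalerA chi_character -scalemxAl mxE.
rewrite complexify_tau scalerA chi_character; apply: (can_inj (mulmxK unitN)).
by apply/rowP => k; rewrite -scalemxAl [RHS]mxE; apply: zX.
Qed.

Lemma Y_chiP (y : 'rV[R[i]]_#|E|) : Y_chi theta chi y <-> Ysym theta s y.
Proof.
split=> [yY i j ij | yY g i j]; first by rewrite (yY _ _ _ ij) chi_N1.
case: (Z2P g) => ->; last by rewrite chi_N1; apply: yY.
by rewrite theta_set1 chi_1 mul1r => /enum_val_inj->.
Qed.

Lemma chi_surjectiveP :
  (forall y : 'rV[R[i]]_#|E|, Y_chi theta chi y -> exists2 z, X_chi theta tau chi z & dC z = y) <->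
  (forall y : 'rV[R[i]]_#|E|, Ysym theta s y -> exists2 z, Xsym theta N s z & dC z = y).
Proof.
by split=> surj y /Y_chiP/surj[z zX dz]; exists z => //; apply/X_chiP.
Qed.

End Character.

Let chi0_1 : @chi0 R 1%g = 1. Proof. by []. Qed.
Let chi0_N1 : @chi0 R neg1 = - (-1). Proof. by rewrite opprK. Qed.
Let chi1_1 : @chi1 R 1%g = 1. Proof. by rewrite /chi1 expr0. Qed.
Let chi1_N1 : @chi1 R neg1 = - 1. Proof. by rewrite /chi1 expr1. Qed.
Let N1_sqr : (-1) * (-1) = 1 :> R[i]. Proof. by rewrite mulrNN mulr1. Qed.
Let one_sqr : 1 * 1 = 1 :> R[i]. Proof. exact: mulr1. Qed.

Lemma two_neq0 : 2 != 0 :> R[i].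
Proof. by rewrite pnatr_eq0. Qed.

(** A constant field [c] with this symmetry satisfies [c = - c]. *)
Lemma T_chi0P eta : T_chi nrm tau (@chi0 R) eta <-> eta = fun=> 0.
Proof.
rewrite /T_chi /=; split=> [[/(complex_motion_fieldsP _ uM nrmE)[c ->] /(_ neg1 0)]|->].
  rewrite complexify_tau /chi0 /character eqxx scale1r scaleN1r => /eqP.
  rewrite -subr_eq0 opprK -mulr2n -scaler_nat scaler_eq0 (negPf two_neq0) => /eqP->.
  by [].
split; first by apply/(complex_motion_fieldsP _ uM nrmE); exists 0.
by move=> g x; rewrite mul0mx scaler0.
Qed.

Lemma T_chi1P eta : T_chi nrm tau (@chi1 R) eta <-> exists c, eta = fun=> c.
Proof.
rewrite /T_chi /=; split=> [[/(complex_motion_fieldsP _ uM nrmE)]//|[c ->]].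
split; first by apply/(complex_motion_fieldsP _ uM nrmE); exists c.
move=> g x; rewrite complexify_tau scalerA (chi_character chi1_1 chi1_N1).
by rewrite /character if_same scale1r.
Qed.

Definition independent_mono (s : R[i]) := forall k (o : qedge E theta), o \in mono k ->
  exists f, [/\ equivariant theta s f, edge_constant (mono k :\ o)%SET f
    & exists v w, [set v; w]%SET \in val o /\ f v <> f w].

(** Here [s = -1], so [surjective_independent] applies also in the presence of fixed edges. *)
Lemma chi0_isostaticP : chi_isostatic nrm E p theta tau (@chi0 R) <->
  (forall k f, equivariant theta (-1 : R[i]) f -> edge_constant (mono k) f ->
     forall v, f v = 0) /\ independent_mono (-1).
Proof.
rewrite -(kernel0P nrm_norm uM nrmE G_symmetric wpos unitN edge_signC_neq0 complex_differentialE).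
have trivialP z : (exists2 eta, T_chi nrm tau (@chi0 R) eta
     & forall v, at_vertex z v = eta (at_vertex p v)) <-> z = 0.
  split=> [[eta /T_chi0P-> z0] | ->].
    by apply: at_vertex_inj => v; rewrite z0 at_vertex0.
  by exists (fun=> 0); [apply/T_chi0P | move=> v; rewrite at_vertex0].
rewrite /chi_isostatic; split=> -[kerE surj].
  split=> [z zX dz|].
    apply/trivialP.
    by have : [set x | X_chi theta tau (@chi0 R) x /\ dC x = 0]%classic z;
       [split=> //; apply/(X_chiP chi0_1 chi0_N1) | rewrite kerE].
  move/(chi_surjectiveP chi0_1 chi0_N1): surj => surj.
  exact: (surjective_independent nrm_norm G_symmetric edge_signC_neq0
    complex_differentialE N1_sqr (or_introl (erefl _)) surj).
split; last first.
  apply/(chi_surjectiveP chi0_1 chi0_N1).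
  exact: (independent_surjective nrm_norm uM nrmE G_symmetric wpos unitN edge_signC_neq0
    edge_signC_theta complex_differentialE surj).
apply/seteqP; split=> z /=; first by move=> [/(X_chiP chi0_1 chi0_N1) zX dz]; apply/trivialP/kerE.
move/trivialP=> ->; split.
  by apply/(X_chiP chi0_1 chi0_N1) => k g v; rewrite /coord !at_vertex0 !mul0mx !mxE mulr0.
apply: (D_const nrm_norm uM nrmE G_symmetric wpos edge_signC_neq0 complex_differentialE).
by move=> v w; rewrite !at_vertex0.
Qed.

Lemma const_Xsym1 (z : 'M[R[i]]_(#|V|, 2)) :
  (forall v w, at_vertex z v = at_vertex z w) -> Xsym theta N 1 z.
Proof.
by move=> zc k g v; rewrite /coord (zc _ v) /character if_same mul1r.
Qed.

(** Here [s = 1], and a symmetric vector vanishes at a fixed edge; so surjectivity gives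
    independence at every orbit only under [no_fixed_edge]. *)
Lemma chi1_isostaticP :
  ((forall k f, equivariant theta (1 : R[i]) f -> edge_constant (mono k) f ->
     forall v w, f v = f w) /\ independent_mono 1 ->
   chi_isostatic nrm E p theta tau (@chi1 R)) /\
  (no_fixed_edge E theta -> chi_isostatic nrm E p theta tau (@chi1 R) ->
   (forall k f, equivariant theta (1 : R[i]) f -> edge_constant (mono k) f ->
     forall v w, f v = f w) /\ independent_mono 1).
Proof.
rewrite -(kernel_equivariant_constP nrm_norm uM nrmE G_symmetric wpos unitN edge_signC_neq0
  complex_differentialE).
have trivialP z : (exists2 eta, T_chi nrm tau (@chi1 R) eta
     & forall v, at_vertex z v = eta (at_vertex p v)) <->
     forall v w, at_vertex z v = at_vertex z w.
  split=> [[eta /T_chi1P[c ->] zv] v w | zc]; first by rewrite !zv.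
  have [[v0 _] | noV] := EM (exists v : V, True); last first.
    exists (fun=> 0); first by apply/T_chi1P; exists 0.
    by move=> v; case: noV; exists v.
  exists (fun=> at_vertex z v0); last by move=> v; apply: zc.
  by apply/T_chi1P; exists (at_vertex z v0).
rewrite /chi_isostatic; split=> [[kerE indep]|no_fixed [kerE surj]]; last first.
  split=> [z zX dz|].
    apply/trivialP.
    by have : [set x | X_chi theta tau (@chi1 R) x /\ dC x = 0]%classic z;
       [split=> //; apply/(X_chiP chi1_1 chi1_N1) | rewrite kerE].
  move/(chi_surjectiveP chi1_1 chi1_N1): surj => surj.
  exact: (surjective_independent nrm_norm G_symmetric edge_signC_neq0
    complex_differentialE one_sqr (or_intror no_fixed) surj).
split; last first.
  apply/(chi_surjectiveP chi1_1 chi1_N1).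
  exact: (independent_surjective nrm_norm uM nrmE G_symmetric wpos unitN edge_signC_neq0
    edge_signC_theta complex_differentialE indep).
apply/seteqP; split=> z /=; first by move=> [/(X_chiP chi1_1 chi1_N1) zX dz]; apply/trivialP/kerE.
move/trivialP=> zc; split; first exact/(X_chiP chi1_1 chi1_N1)/const_Xsym1.
exact: (D_const nrm_norm uM nrmE G_symmetric wpos edge_signC_neq0 complex_differentialE).
Qed.

End Isostaticity.

(** * Assembly of the three characterisations *)

Theorem theorem4p2 (R : realType) (nrm : 'rV[R]_2 -> R) (F1 F2 : set 'rV[R]_2)
    (nrm_norm : is_norm nrm)
    (ball_quadrilateral : quadrilateral (unit_ball nrm))
    (ball_facets : facets (unit_ball nrm) =
                   [set F1; opp_set F1; F2; opp_set F2]%classic)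
    (V : finType) (E : {set {set V}}) (p : 'M[R]_(#|V|, 2))
    (theta : {morphism [set: 'Z_2]%SET >-> {perm V}})
    (tau : mx_representation R [set: 'Z_2]%SET 2)
    (G_symmetric : C2_symmetric_framework nrm E p theta tau)
    (G_well_positioned : well_positioned nrm E p)
    (rep : qvert theta -> V) (rep_orbit : representatives rep) :
  let G0 := quotient_gain_graph E rep in
  let GF1 : {set gedge G0} := monochrome nrm E p theta F1 in
  let GF2 : {set gedge G0} := monochrome nrm E p theta F2 in
  [/\ chi_isostatic nrm E p theta tau (@chi0 R) <->
        [/\ [disjoint GF1 & GF2],
            unbalanced_map_graph GF1 & unbalanced_map_graph GF2],

      ([/\ [disjoint GF1 & GF2], is_tree GF1 & is_tree GF2] ->
         chi_isostatic nrm E p theta tau (@chi1 R)) /\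
      (no_fixed_edge E theta ->
         chi_isostatic nrm E p theta tau (@chi1 R) ->
         [/\ [disjoint GF1 & GF2], is_tree GF1 & is_tree GF2])

    & infinitesimally_rigid nrm E p <->
        (exists D1 : {set gedge G0}, [/\ D1 \subset GF1, connected_graph D1
                      & unbalanced_map_graph D1]) /\
        (exists D2 : {set gedge G0}, [/\ D2 \subset GF2, connected_graph D2
                      & unbalanced_map_graph D2])].
Proof.
move=> G0 GF1 GF2; have [ball_polytope _] := ball_quadrilateral.
have [M [uM nrmE F1E F2E]] := quadrilateral_normP nrm_norm ball_polytope ball_facets.
have sym : Z2_symmetric_graph E theta by case: G_symmetric.
have GF1E : GF1 = mono nrm M E p theta 0 by rewrite /GF1 F1E.
have GF2E : GF2 = mono nrm M E p theta 1 by rewrite /GF2 F2E.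
have disj : [disjoint GF1 & GF2].
  rewrite GF1E GF2E.
  exact: (mono_disjoint nrm_norm uM nrmE G_symmetric G_well_positioned).
(* Conditions on both colours become conditions on every coordinate [k], the form in which the
   function criteria are stated. *)
have all_k (P : 'I_2 -> Prop) : (forall k, P k) <-> P 0 /\ P 1.
  by split=> [Pk | [P0 P1] k]; [split | case: (ord2P k) => ->].
have two0 : 2 != 0 :> R[i] by rewrite pnatr_eq0.
split.
- rewrite (chi0_isostaticP nrm_norm uM nrmE G_symmetric G_well_positioned).
  have -> : [/\ [disjoint GF1 & GF2], unbalanced_map_graph GF1 & unbalanced_map_graph GF2] <->
      forall k, @unbalanced_map_graph G0 (mono nrm M E p theta k).
    by rewrite all_k -GF1E -GF2E; split=> [[]|[]].
  split=> [[ker0 indep] k | mapk].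
    by apply/(unbalanced_map_graph_equivariant sym rep_orbit two0); split;
      [apply: ker0 | apply: indep].
  by split=> k; have /(unbalanced_map_graph_equivariant sym rep_orbit two0)[] := mapk k.
- have -> : [/\ [disjoint GF1 & GF2], is_tree GF1 & is_tree GF2] <->
      forall k, @is_tree G0 (mono nrm M E p theta k).
    by rewrite all_k -GF1E -GF2E; split=> [[]|[]].
  have [suff nec] := chi1_isostaticP nrm_norm uM nrmE G_symmetric G_well_positioned.
  split=> [treek | no_fixed iso k].
    apply: suff.
    by split=> k; have /(is_tree_equivariant sym rep_orbit R[i])[] := treek k.
  have [ker indep] := nec no_fixed iso.
  by apply/(is_tree_equivariant sym rep_orbit R[i]); split; [apply: ker | apply: indep].
rewrite (infinitesimally_rigidP nrm_norm uM nrmE G_symmetric G_well_positioned).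
have two0R : 2 != 0 :> R by rewrite pnatr_eq0.
rewrite !(connected_map_graph_equivariant sym rep_orbit two0R) GF1E GF2E.
exact: all_k.
Qed.
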